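(* Let $G=(V,E)$ be a minimally $d$-rigid graph with at least $d+1$ vertices and let $G'$ be obtained from $G$ by a $d$-dimensional spider-split. Then $c_d(G')\ge c_d(G)$.
   Context: A $d$-dimensional spider-split takes a graph $G$, a vertex $x$, and a partition of the neighbourhood of $x$ into sets $N_1$, $N_2$ and $\{w_1,\dots,w_d\}$; it outputs the graph obtained from $G-x$ by adding new vertices $x_1,x_2$, with $x_i$ joined to all of $N_i$ ($i=1,2$) and both $x_1,x_2$ joined to each of $w_1,\dots,w_d$ (no edge $x_1x_2$). On $\mathbb{C}^d$ use $\|x\|^2=\sum x_i^2$. A realisation is generic if its coordinates are algebraically independent over $\mathbb{Q}$; realisations are equivalent if all edge values $\|p(v)-p(w)\|^2$ agree, congruent if related by $x\mapsto Ax+b$ with $A^TA=AA^T=I$. $G$ is $d$-rigid if some generic framework is rigid, minimally $d$-rigid if moreover $G-e$ is not $d$-rigid for all edges $e$. For a $d$-rigid graph with $|V|\ge d+1$, $c_d(G)$ is the number of congruence classes of complex realisations equivalent to a generic realisation. *)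

(* Defs.v *)
From HB Require Import structures.
From mathcomp Require Import all_boot all_order all_algebra.
From mathcomp Require Import mpoly.
From mathcomp Require Import complex.
From mathcomp Require Import boolp classical_sets cardinality reals.
Set Implicit Arguments.
Unset Strict Implicit.
Unset Printing Implicit Defensive.
Import Order.TTheory GRing.Theory Num.Theory.
Local Open Scope ring_scope.

(* Points of F^d are column vectors 'cV[F]_d.  Squared "norm" ||x||^2 = sum x_i^2
   (no complex conjugation). *)
Definition sqnorm (F : nzRingType) (d : nat) (x : 'cV[F]_d) : F :=
  \sum_(i < d) x i 0 ^+ 2.

(* A graph is a (symmetric, irreflexive) relation E on a finite vertex type V;
   a realisation (framework) is a map p : V -> F^d. *)

Definition equivalent (F : nzRingType) (V : finType) (E : rel V) (d : nat)
  (p q : V -> 'cV[F]_d) : Prop :=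
  forall u w, E u w -> sqnorm (p u - p w) = sqnorm (q u - q w).

Definition congruent (F : nzRingType) (V : finType) (d : nat)
  (p q : V -> 'cV[F]_d) : Prop :=
  exists (A : 'M[F]_d) (b : 'cV[F]_d),
    [/\ A^T *m A = 1%:M, A *m A^T = 1%:M & forall v, q v = A *m p v + b].

Definition coords (F : nzRingType) (V : finType) (d : nat) (p : V -> 'cV[F]_d)
  : 'I_#|{: V * 'I_d}| -> F :=
  fun k => let: (v, i) := enum_val k in p v i 0.

Definition generic (F : fieldType) (V : finType) (d : nat) (p : V -> 'cV[F]_d)
  : Prop :=
  forall P : {mpoly rat[#|{: V * 'I_d}|]},
    P != 0 -> (map_mpoly (ratr : rat -> F) P).@[coords p] != 0.

Definition rigid_framework (R : realType) (V : finType) (E : rel V) (d : nat)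
  (p : V -> 'cV[R]_d) : Prop :=
  exists eps : R, 0 < eps /\
    forall q : V -> 'cV[R]_d, equivalent E p q ->
      (forall v i, `|q v i 0 - p v i 0| < eps) -> congruent p q.

Definition d_rigid (R : realType) (d : nat) (V : finType) (E : rel V) : Prop :=
  exists p : V -> 'cV[R]_d, generic p /\ rigid_framework E p.

Definition remove_edge (V : finType) (E : rel V) (u w : V) : rel V :=
  fun a b => E a b && ~~ (((a == u) && (b == w)) || ((a == w) && (b == u))).

Definition minimally_d_rigid (R : realType) (d : nat) (V : finType) (E : rel V)
  : Prop :=
  d_rigid R d E /\ forall u w, E u w -> ~ d_rigid R d (remove_edge E u w).

(* The set of congruence classes of complex realisations equivalent to p;
   c_d(G) is its cardinality when p is a generic complex realisation. *)
Definition congruence_classes (C : fieldType) (V : finType) (E : rel V) (d : nat)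
  (p : V -> 'cV[C]_d) : set (set (V -> 'cV[C]_d)) :=
  (fun K => exists q : V -> 'cV[C]_d,
             equivalent E p q /\ K = (fun r => congruent q r)).

(* d-dimensional spider-split of (V,E) at x with neighbourhood partition
   N1, N2, W.  The new graph has vertex set option V: [Some v] (v <> x) is the
   old vertex v, [Some x] plays the role of x1 and [None] plays the role of x2. *)
Definition spider_split (V : finType) (E : rel V) (x : V) (N1 N2 W : {set V})
  : rel (option V) :=
  fun a b =>
    match a, b with
    | Some u, Some w =>
        if u == x then (w != x) && ((w \in N1) || (w \in W))
        else if w == x then (u \in N1) || (u \in W)
        else E u w
    | Some u, None => (u != x) && ((u \in N2) || (u \in W))
    | None, Some w => (w != x) && ((w \in N2) || (w \in W))
    | None, None => false
    end.

(* Main.v *)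
(* For a framework X let f_E(X) be the vector of squared edge lengths.
   Minimality makes the entries of f_E(p) algebraically independent over Q at a
   generic p, and rigidity makes every polynomial in the squared distances
   algebraic over Q(f_E(p)); the latter is the only place where real analysis
   enters (a contraction argument solves a quadratic system near p).

   Independence of f_E(q) = f_E(p), for q equivalent to p, yields derivations
   of the field dual to f_E(q), hence the differential of f_E at q is onto.
   Algebraicity shows that the d vectors q(w) - q(x), w in W, are independent
   and that q is determined up to congruence by its squared distances, which
   take finitely many values.

   Let q' be the degenerate realisation of the spider-split G' in which both
   copies of x are placed at q(x). The edge values of q' do not depend on q, and
   the differential at q' is still onto. Choose a combination h of squared
   distances separating the classes of realisations of G. Over the field
   generated by f_E'(p'), all conjugates of h(p') are values of h at
   realisations equivalent to p' (extension of embeddings into C), so h(p') has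
   a minimal polynomial whose degree is at most c_d(G'). This gives an identity
   a(f_E'(X), h(X)) = 0, and the lowest-order part of a at the common edge
   values of the q' is a nonzero polynomial, of no larger degree, vanishing at
   all the distinct values h(q'). *)

Require Import Defs.
From HB Require Import structures.
From mathcomp Require Import all_boot all_order all_algebra.
From mathcomp Require Import boolp classical_sets cardinality reals.
From mathcomp Require Import ring lra.
Set Implicit Arguments.
Unset Strict Implicit.
Unset Printing Implicit Defensive.
Import Order.TTheory GRing.Theory Num.Theory.
Local Open Scope ring_scope.

(** * Real numbers *)

(* The notations of MathComp-Analysis clash with those of [mpoly]. *)
Module RealAnalysis.
From mathcomp Require Import functions interval_inference.
From mathcomp Require Import topology normedtype sequences.
Import numFieldNormedType.Exports.
Local Open Scope classical_set_scope.

(** Baire's theorem: the complements of the points [u n] are open and dense, so they have a common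
    element. *)
Lemma real_uncountable (R : realType) (u : nat -> R) :
  exists c, forall n, u n != c.
Proof.
have [//||c [_ cP]] := @Baire R R (fun n => ~` [set u n]) _ setT _ openT.
- move=> n; split.
    exact/closed_openC/accessible_closed_set1/hausdorff_accessible/Rhausdorff.
  move=> O [x Ox] Oopen.
  have /nbhs_ballP[e /= e0 eO] := open_nbhs_nbhs (conj Oopen Ox).
  have [xu|xu] := eqVneq x (u n); last by exists x; split=> //; apply/eqP.
  exists (x + e / 2); split.
    apply: eO; rewrite /ball /= opprD addrA subrr sub0r normrN.
    by rewrite gtr0_norm ?divr_gt0 // ltr_pdivrMr // ltr_pMr // ltr1n.
  move=> /= /eqP; rewrite -xu -subr_eq0 addrAC subrr add0r.
  by rewrite gt_eqF // divr_gt0.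
- by exists 0.
by exists c => n; have := cP n I => /= /eqP; rewrite eq_sym.
Qed.

HB.instance Definition _ (R : realType) m n :=
  Uniform_isComplete.Build 'M[R]_(m, n) cauchy_cvg.

Lemma mx_norm_le (R : realType) n (w : 'cV[R]_n) r : 0 <= r ->
  (forall i, `|w i 0| <= r) -> `|w| <= r.
Proof.
move=> r0 wr; rewrite [leLHS]/Num.Def.normr /= mx_normrE; apply/bigmax_leP.
by split=> // -[i j] _ /=; rewrite ord1.
Qed.

Lemma entry_le_mx_norm (R : realType) n (w : 'cV[R]_n) i : `|w i 0| <= `|w|.
Proof.
rewrite [leRHS]/Num.Def.normr /= mx_normrE.
by apply: (le_bigmax _ (fun ij : 'I_n * 'I_1 => `|w ij.1 ij.2|) (i, 0)).
Qed.

(** The solution is a fixed point of [w |-> b - Q w], with [Q] the quadratic part; Banach's theorem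
    applies to this map on a small closed ball. *)
Lemma quadratic_perturbation (R : realType) n (C : 'I_n -> 'I_n -> 'I_n -> R)
    (eps : R) : 0 < eps ->
  exists eta : R, 0 < eta /\ forall b : 'I_n -> R, (forall i, `|b i| <= eta) ->
    exists w : 'I_n -> R, (forall i, `|w i| <= eps) /\
      forall i, w i + \sum_j \sum_k C i j k * (w j * w k) = b i.
Proof.
move=> eps0; pose K := 1 + \sum_i \sum_j \sum_k `|C i j k|.
have K1 : 1 <= K by rewrite lerDl; do 3!apply: sumr_ge0 => ? _.
have K0 : 0 < K := lt_le_trans ltr01 K1.
have CK i : \sum_j \sum_k `|C i j k| <= K.
  rewrite /K [X in _ <= 1 + X](bigD1 i) //= addrCA lerDl addr_ge0 ?ler01 //.
  by do 3!apply: sumr_ge0 => ? _.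
(* The bound [K * r <= 1/4] gives both the Lipschitz constant [2 * K * r <= 1/2] and, for [b]
   bounded by [r / 2], the stability of the ball of radius [r]. *)
pose r := Num.min eps (4 * K)^-1.
have r0 : 0 < r by rewrite lt_min eps0 invr_gt0 mulr_gt0.
have rK : K * r <= 4^-1.
  rewrite -ler_pdivlMl // -invfM mulrC ge_min; apply/orP; right.
  by [].
have reps : r <= eps by rewrite ge_min lexx.
exists (r / 2); split=> [|b br]; first by rewrite divr_gt0.
pose Q (w : 'cV[R]_n) i := \sum_j \sum_k C i j k * (w j 0 * w k 0).
pose f (w : 'cV[R]_n) : 'cV[R]_n := \col_i (b i - Q w i).
pose U : set 'cV[R]_n := [set w | `|w| <= r].
have bound i (g : 'I_n -> 'I_n -> R) t : 0 <= t -> (forall j k, `|g j k| <= t) ->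
    `|\sum_j \sum_k C i j k * g j k| <= K * t.
  move=> t0 gt; apply: le_trans (ler_wpM2r t0 (CK i)).
  rewrite mulr_suml; apply: le_trans (ler_norm_sum _ _ _) _.
  apply: ler_sum => j _; rewrite mulr_suml.
  apply: le_trans (ler_norm_sum _ _ _) _; apply: ler_sum => k _.
  by rewrite normrM ler_wpM2l.
have Uf : set_fun U U f.
  move=> w /= wr; apply: mx_norm_le => [|i]; first exact: ltW.
  rewrite mxE; apply: le_trans (ler_normB _ _) _.
  have wi j := le_trans (entry_le_mx_norm w j) wr.
  have QK : `|Q w i| <= K * (r * r).
    apply: bound => [|j k]; first by rewrite mulr_ge0 // ltW.
    by rewrite normrM ler_pM.
  have := ler_wpM2r (ltW r0) rK; have := br i; lra.
pose g : {fun U >-> U} := HB.pack f (isFun.Build _ _ U U f Uf).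
have gP : is_contraction g.
  exists (2^-1)%:nng; split; first by rewrite /= invf_lt1 ?ltr1n.
  move=> [w w'] /= [wr wr'].
  apply: mx_norm_le => [|i]; first by rewrite mulr_ge0 ?invr_ge0.
  rewrite !mxE opprD opprK addrACA subrr add0r addrC -opprB normrN /Q.
  have -> : \sum_j \sum_k C i j k * (w j 0 * w k 0) -
      \sum_j \sum_k C i j k * (w' j 0 * w' k 0) =
      \sum_j \sum_k C i j k * (w j 0 * w k 0 - w' j 0 * w' k 0).
    rewrite -sumrB; apply: eq_bigr => j _; rewrite -sumrB.
    by apply: eq_bigr => k _; rewrite mulrBr.
  set t := `|w - w'|; have t0 : 0 <= t by exact: normr_ge0.
  apply: (@le_trans _ _ (K * (2 * r * t))).
    apply: bound => [|j k]; first by rewrite mulr_ge0 ?mulr_ge0 // ltW.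
    have -> : w j 0 * w k 0 - w' j 0 * w' k 0 =
        (w j 0 - w' j 0) * w k 0 + w' j 0 * (w k 0 - w' k 0) by ring.
    have tE l : `|w l 0 - w' l 0| <= t.
      by have := entry_le_mx_norm (w - w') l; rewrite !mxE.
    have wl l := le_trans (entry_le_mx_norm w l) wr.
    have wl' l := le_trans (entry_le_mx_norm w' l) wr'.
    apply: le_trans (ler_normD _ _) _; rewrite !normrM.
    have -> : 2 * r * t = t * r + r * t by ring.
    by apply: lerD; apply: ler_pM.
  have := ler_wpM2r t0 rK; lra.
have Ucl : closed U.
  have -> : U = closed_ball (0 : 'cV[R]_n) r.
    rewrite closed_ballE //; apply/seteqP; split=> w;
      by rewrite /closed_ball_ /= sub0r normrN.
  exact: closed_ball_closed.
have [|w Uw wE] := banach_fixed_point gP Ucl.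
  by exists 0; rewrite /U /= normr0 ltW.
exists (fun i => w i 0); split=> [i|i].
  exact: le_trans (le_trans (entry_le_mx_norm w i) Uw) reps.
have := congr1 (fun v : 'cV[R]_n => v i 0) wE; rewrite mxE => {1}->.
by rewrite subrK.
Qed.

End RealAnalysis.

From mathcomp Require Import mpoly.
From mathcomp Require Import complex.

(** * Extension of derivations and of embeddings *)

Section MinimalRelation.
Variables (A : comNzRingType) (F : fieldType) (e : {rmorphism A -> F}) (c : F).

(** The ring [A] stands for its image [e A] in [F]. As [e] may have a kernel, nullity of a
    polynomial is tested after applying [e]. *)
Definition transcendental :=
  forall P : {poly A}, (map_poly e P).[c] = 0 -> map_poly e P = 0.

(** A denominator-free form of the minimal polynomial of [c] over the fraction field of [e A]:
    instead of being monic, its leading coefficient must survive [e]. *)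
Definition minimal_relation (M : {poly A}) :=
  [/\ e (lead_coef M) != 0, (map_poly e M).[c] = 0
    & forall P : {poly A}, (size P < size M)%N ->
        (map_poly e P).[c] = 0 -> map_poly e P = 0].

(** Among the relations with nonzero image, one of least size is taken. If [e] killed its leading
    coefficient, dropping the top term would give a shorter one. *)
Lemma minimal_relation_exists :
  transcendental \/ exists M, minimal_relation M.
Proof.
have [tr|ntr] := EM transcendental; [by left | right].
pose good n := `[< exists P : {poly A},
  [/\ size P = n, (map_poly e P).[c] = 0 & map_poly e P != 0] >].
have exg : exists n, good n.
  move/existsNP: ntr => [P] /not_implyP[P0 PN].
  by exists (size P); apply/asboolP; exists P; split=> //; apply/eqP.
case: (ex_minnP exg) => n /asboolP[M [sM M0 MN]] nmin.
have small (P : {poly A}) : (size P < size M)%N -> (map_poly e P).[c] = 0 ->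
    map_poly e P = 0.
  move=> sP P0; apply/eqP/negP => /negP PN.
  have /nmin : good (size P) by apply/asboolP; exists P.
  by rewrite -sM leqNgt sP.
exists M; split=> //; apply/negP => /eqP lead0.
have sM_gt0 : (0 < size M)%N.
  by rewrite lt0n size_poly_eq0; apply: contraNneq MN => ->; rewrite rmorph0.
pose M' := take_poly (size M).-1 M.
have eM' : map_poly e M' = map_poly e M.
  apply/polyP => i; rewrite !coef_map coef_take_poly.
  have [//|] := ltnP i (size M).-1.
  rewrite leq_eqVlt => /predU1P[<-|].
    by rewrite raddf0 -[RHS]/(e (lead_coef M)) lead0.
  by rewrite prednK // => /leq_sizeP -> //; rewrite raddf0.
have sM' : (size M' < size M)%N.
  by rewrite (leq_ltn_trans (size_take_poly _ _)) // prednK.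
by move/eqP: MN; apply; rewrite -eM'; apply: small => //; rewrite eM'.
Qed.

Variable M : {poly A}.
Hypothesis minM : minimal_relation M.

(** Pseudo-division by [M], whence the power of its leading coefficient; the remainder is a relation
    shorter than [M]. *)
Lemma minimal_relation_reduce (P : {poly A}) :
  (map_poly e P).[c] = 0 ->
  exists k Q S, lead_coef M ^+ k *: P = Q * M + S /\ map_poly e S = 0.
Proof.
case: minM => leadM M0 small P0.
have Mn0 : M != 0 by apply: contraNneq leadM => ->; rewrite lead_coef0 rmorph0.
exists (Pdiv.CommonRing.rscalp P M), (Pdiv.CommonRing.rdivp P M),
  (Pdiv.CommonRing.rmodp P M); split; first exact: Pdiv.ComRing.rdivp_eq.
apply: small; first by rewrite Pdiv.CommonRing.ltn_rmodp.
have := Pdiv.ComRing.rdivp_eq M P => /(congr1 (fun p => (map_poly e p).[c])).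
rewrite rmorphD rmorphM /= map_polyZ /= hornerZ hornerD hornerM M0 P0.
by rewrite !mulr0 add0r.
Qed.

Lemma size_minimal_relation : size (map_poly e M) = size M.
Proof. by case: minM => leadM _ _; rewrite size_map_poly_id0. Qed.

Lemma size_minimal_relation_gt1 : (1 < size M)%N.
Proof.
case: minM => leadM M0 _; rewrite ltnNge; apply/negP => /size1_polyC ME.
move: leadM M0; rewrite ME lead_coefC map_polyC hornerC /= => + e0.
by rewrite e0 eqxx.
Qed.

Hypothesis char0 : [pchar F] =i pred0.

(** Separability: in characteristic 0 the derivative is shorter than [M] but keeps a nonzero top
    coefficient, so it cannot be a relation. *)
Lemma minimal_relation_deriv : (map_poly e M)^`().[c] != 0.
Proof.
case: minM => leadM M0 small; rewrite deriv_map.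
have sM := size_minimal_relation_gt1.
apply/eqP => /small; rewrite lt_size_deriv; last first.
  by rewrite -size_poly_gt0 (ltn_trans _ sM).
move=> /(_ isT) /(congr1 (fun p : {poly F} => p`_(size M).-2)).
rewrite coef0 coef_map coef_deriv raddfMn /=.
move: sM; case sM: (size M) => [|[|n]] //= _.
move/eqP; rewrite -mulr_natl mulf_eq0 (iffLR (pcharf0P F) char0) /=.
by move: leadM; rewrite lead_coefE sM /= => /negPf ->.
Qed.

End MinimalRelation.

(* A derivation of the subring [e A] of [F] with values in [F], described
   through its composite with [e]. *)
Definition eval_derivation (A : comNzRingType) (F : fieldType)
    (e : {rmorphism A -> F}) (D : A -> F) :=
  [/\ forall a b, D (a + b) = D a + D b,
      forall a b, D (a * b) = e a * D b + D a * e b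
    & forall a, e a = 0 -> D a = 0].

Section EvaluationDerivation.
Variables (A : comNzRingType) (F : fieldType) (e : {rmorphism A -> F}).
Variable D : A -> F.
Hypothesis derD : eval_derivation e D.

Lemma eval_derivationD a b : D (a + b) = D a + D b.
Proof. by case: derD. Qed.

Lemma eval_derivationM a b : D (a * b) = e a * D b + D a * e b.
Proof. by case: derD. Qed.

Lemma eval_derivation_ker a : e a = 0 -> D a = 0.
Proof. by case: derD => _ _; apply. Qed.

Lemma eval_derivation0 : D 0 = 0.
Proof. by apply: eval_derivation_ker; rewrite rmorph0. Qed.

Lemma eval_derivationN a : D (- a) = - D a.
Proof. by apply: (addrI (D a)); rewrite -eval_derivationD !subrr eval_derivation0. Qed.

Lemma eval_derivationB a b : D (a - b) = D a - D b.
Proof. by rewrite eval_derivationD eval_derivationN. Qed.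

Lemma eval_derivation1 : D 1 = 0.
Proof.
have := eval_derivationM 1 1; rewrite mulr1 rmorph1 mul1r mulr1.
by move/eqP; rewrite -subr_eq0 opprD addrA subrr sub0r oppr_eq0 => /eqP.
Qed.

Lemma eval_derivation_sum (I : Type) (r : seq I) (P : pred I) (G : I -> A) :
  D (\sum_(i <- r | P i) G i) = \sum_(i <- r | P i) D (G i).
Proof. exact: (big_morph _ eval_derivationD eval_derivation0). Qed.

Lemma eval_derivation_eq a b : e a = e b -> D a = D b.
Proof.
move=> eab; apply/eqP; rewrite -subr_eq0 -eval_derivationB; apply/eqP.
by apply: eval_derivation_ker; rewrite rmorphB /= eab subrr.
Qed.

(** The derivation of [{poly A}] that extends [D] and sends the indeterminate, evaluated at [c], to
    [w]. *)
Definition poly_derivation (c w : F) (P : {poly A}) :=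
  (map_poly D P).[c] + (map_poly e P)^`().[c] * w.

Lemma poly_derivationD c w P Q :
  poly_derivation c w (P + Q) = poly_derivation c w P + poly_derivation c w Q.
Proof.
have DD : map_poly D (P + Q) = map_poly D P + map_poly D Q.
  apply/polyP => i; rewrite coefD !coef_map_id0 ?eval_derivation0 //.
  by rewrite coefD eval_derivationD.
by rewrite /poly_derivation DD rmorphD derivD !hornerD; ring.
Qed.

Lemma poly_derivationM c w P Q :
  poly_derivation c w (P * Q) =
  (map_poly e P).[c] * poly_derivation c w Q
  + poly_derivation c w P * (map_poly e Q).[c].
Proof.
have DM : map_poly D (P * Q) =
    map_poly e P * map_poly D Q + map_poly D P * map_poly e Q.
  apply/polyP => i; rewrite coefD !coefM coef_map_id0 ?eval_derivation0 //.
  rewrite coefM eval_derivation_sum -big_split /=; apply: eq_bigr => j _.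
  by rewrite !coef_map_id0 ?eval_derivation0 ?rmorph0 // eval_derivationM.
rewrite /poly_derivation DM rmorphM derivM !hornerD !hornerM.
by ring.
Qed.

Definition ext_eval (c : F) : {poly A} -> F := horner_eval c \o map_poly e.
HB.instance Definition _ c := GRing.RMorphism.on (ext_eval c).

Lemma ext_evalE c P : ext_eval c P = (map_poly e P).[c].
Proof. by []. Qed.

Lemma ext_evalC c a : ext_eval c a%:P = e a.
Proof. by rewrite ext_evalE map_polyC hornerC. Qed.

Lemma ext_evalX c : ext_eval c 'X = c.
Proof. by rewrite ext_evalE map_polyX hornerX. Qed.

Lemma poly_derivationC c w a : poly_derivation c w a%:P = D a.
Proof.
rewrite /poly_derivation map_polyC derivC horner0 mul0r addr0.
have -> : map_poly D a%:P = (D a)%:P.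
  apply/polyP => i; rewrite coef_map_id0 ?eval_derivation0 // !coefC.
  by case: ifP => // _; rewrite eval_derivation0.
by rewrite hornerC.
Qed.

Lemma poly_derivation_ker0 c w P : map_poly e P = 0 -> poly_derivation c w P = 0.
Proof.
move=> eP0; rewrite /poly_derivation eP0 deriv0 horner0 mul0r addr0.
have -> : map_poly D P = 0; last by rewrite horner0.
apply/polyP => i; rewrite coef0 coef_map_id0 ?eval_derivation0 //.
by apply: eval_derivation_ker; rewrite -coef_map eP0 coef0.
Qed.

Lemma eval_derivation_transcendental c w : transcendental e c ->
  eval_derivation (ext_eval c) (poly_derivation c w).
Proof.
move=> tr; split=> [P Q|P Q|P P0].
- exact: poly_derivationD.
- exact: poly_derivationM.
- exact/poly_derivation_ker0/tr.
Qed.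

Hypothesis char0 : [pchar F] =i pred0.

(** For a transcendental [c] any [w] will do. For an algebraic [c] the minimal relation dictates
    [w], and pseudo-division carries the vanishing from [M] to every relation. *)
Lemma eval_derivation_ext c :
  exists w, eval_derivation (ext_eval c) (poly_derivation c w).
Proof.
have [tr|[M minM]] := minimal_relation_exists e c.
  by exists 0; exact: eval_derivation_transcendental.
have dM := minimal_relation_deriv minM char0.
pose w := - (map_poly D M).[c] / (map_poly e M)^`().[c].
have DM : poly_derivation c w M = 0.
  by rewrite /poly_derivation [_ * w]mulrC divfK // subrr.
exists w; split=> [P Q|P Q|P P0].
- exact: poly_derivationD.
- exact: poly_derivationM.
have [k [Q [S [PE S0]]]] := minimal_relation_reduce minM P0.
have [leadM M0 _] := minM.
have := congr1 (poly_derivation c w) PE.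
rewrite -mul_polyC poly_derivationM poly_derivationD poly_derivationM.
rewrite (poly_derivation_ker0 _ _ S0) DM M0 mulr0 mulr0 !addr0.
rewrite -!ext_evalE ext_evalC rmorphXn [ext_eval c P]P0 mulr0 addr0.
by move/eqP; rewrite mulf_eq0 expf_eq0 (negPf leadM) andbF /= => /eqP.
Qed.

End EvaluationDerivation.

(** Only the finitely many elements of [s] have to be reached. They are adjoined one by one, so [B]
    is an iterated polynomial ring over [A], and [l] picks a preimage of each of them. *)
Lemma lift_derivation (F : fieldType) (char0 : [pchar F] =i pred0)
    (s : seq F) (A : comNzRingType) (e : {rmorphism A -> F}) (D : A -> F) :
  eval_derivation e D ->
  exists (B : comNzRingType) (j : {rmorphism A -> B}) (e' : {rmorphism B -> F})
    (D' : B -> F) (l : F -> B),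
  [/\ eval_derivation e' D', forall a, e' (j a) = e a, forall a, D' (j a) = D a
    & {in s, cancel l e'}].
Proof.
elim: s A e D => [|c s IHs] A e D derD.
  by exists A, idfun, e, D, (fun=> 0); split.
have [w derD'] := eval_derivation_ext derD char0 c.
have [B [j [e' [D' [l [derD'' ej Dj le]]]]]] := IHs _ _ _ derD'.
exists B, (j \o polyC), e', D', (fun x => if x == c then j 'X else l x).
split=> // [a|a|x].
- exact: etrans (ej _) (ext_evalC _ _ _).
- exact: etrans (Dj _) (poly_derivationC derD _ _ _).
rewrite inE; case: eqP => [-> _|_ /=]; first exact: etrans (ej _) (ext_evalX _ _).
exact: le.
Qed.

(** For ring morphisms this says that [e a |-> f a] is an isomorphism between the two images; field
    embeddings are encoded in this way. *)
Definition same_kernel (A : comNzRingType) (F : fieldType) (e f : A -> F) :=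
  forall a, (e a == 0) = (f a == 0).

Section SameKernel.
Variables (A : comNzRingType) (F : fieldType).
Variables e f : {rmorphism A -> F}.
Hypothesis kerE : same_kernel e f.

Lemma same_kernel_map_poly P : (map_poly e P == 0) = (map_poly f P == 0).
Proof.
apply/eqP/eqP => /polyP P0; apply/polyP => i; have := P0 i;
  rewrite !coef_map !coef0 /= => /eqP; [rewrite kerE|rewrite -kerE];
  by move=> /eqP.
Qed.

Lemma minimal_relation_small c M (P : {poly A}) : minimal_relation e c M ->
  (size (map_poly e P) < size M)%N -> (map_poly e P).[c] = 0 -> map_poly e P = 0.
Proof.
move=> [_ _ small] sP P0; pose P' := take_poly (size (map_poly e P)) P.
have eP' : map_poly e P' = map_poly e P.
  apply/polyP => i; rewrite !coef_map coef_take_poly.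
  have [//|] := ltnP i (size (map_poly e P)).
  by move=> /leq_sizeP /(_ _ (leqnn i)); rewrite coef_map => ->; rewrite raddf0.
rewrite -eP' small ?eP' // (leq_ltn_trans _ sP) //; exact: size_take_poly.
Qed.

(* The minimal relation is irreducible over the fraction field of [e A], so
   that all its roots look alike from the point of view of that field. *)
Lemma same_kernel_root c c' M : minimal_relation e c M ->
  (map_poly f M).[c'] = 0 -> same_kernel (ext_eval e c) (ext_eval f c').
Proof.
move=> minM M0'; have [leadM M0 smallM] := minM.
have direct P : (map_poly e P).[c] = 0 -> (map_poly f P).[c'] = 0.
  move=> P0; have [k [Q [S [PE S0]]]] := minimal_relation_reduce minM P0.
  have S0' : map_poly f S = 0 by apply/eqP; rewrite -same_kernel_map_poly S0.
  have := congr1 (fun p => (map_poly f p).[c']) PE.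
  rewrite rmorphD rmorphM /= map_polyZ /= hornerZ hornerD hornerM S0' horner0.
  rewrite M0' mulr0 addr0 rmorphXn => /eqP; rewrite mulf_eq0 expf_eq0.
  by rewrite -kerE (negPf leadM) andbF /= => /eqP.
have fM_neq0 : map_poly f M != 0.
  rewrite -same_kernel_map_poly -size_poly_gt0 (size_minimal_relation minM).
  exact: ltnW (size_minimal_relation_gt1 minM).
have [N minN] : exists N, minimal_relation f c' N.
  have [tr|//] := minimal_relation_exists f c'.
  by move: fM_neq0; rewrite (tr _ M0') eqxx.
have [leadN N0' _] := minN; have leadN' : e (lead_coef N) != 0 by rewrite kerE.
have sN : size (map_poly e N) = size N by rewrite size_map_poly_id0.
(* Up to a nonzero constant, [N] divides [M] over [f], hence also over [e]. If [N] did not vanish at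
   [c], the cofactor would, against the minimality of [M]. *)
have N0 : (map_poly e N).[c] = 0.
  have [k [Q [S [ME S0]]]] := minimal_relation_reduce minN M0'.
  have S0' : map_poly e S = 0 by apply/eqP; rewrite same_kernel_map_poly S0.
  have eME : e (lead_coef N) ^+ k *: map_poly e M = map_poly e Q * map_poly e N.
    have := congr1 (map_poly e) ME.
    by rewrite map_polyZ rmorphD rmorphM /= S0' addr0 rmorphXn.
  have Q_neq0 : map_poly e Q != 0.
    apply: contraNneq fM_neq0 => Q0; rewrite -same_kernel_map_poly.
    move/eqP: eME; rewrite Q0 mul0r scaler_eq0 expf_eq0 (negPf leadN') andbF.
    by [].
  have N_neq0 : map_poly e N != 0.
    rewrite -size_poly_gt0 sN; exact: ltnW (size_minimal_relation_gt1 minN).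
  have := congr1 (fun p => p.[c]) eME.
  rewrite hornerZ M0 mulr0 hornerM => /esym/eqP; rewrite mulf_eq0.
  case/orP => [/eqP Q0|/eqP //].
  case: (negP Q_neq0); apply/eqP; apply: (minimal_relation_small minM _ Q0).
  have := congr1 (size \o polyseq) eME; rewrite /= size_scale ?expf_neq0 //.
  rewrite size_mul // sN (size_minimal_relation minM) => ->.
  have := size_minimal_relation_gt1 minN.
  by case: (size N) => [|[|n]] // _; rewrite addnS /= addnS ltnS leq_addr.
move=> P; apply/eqP/eqP; first exact: direct.
move=> P0; have [k [Q [S [PE S0]]]] := minimal_relation_reduce minN P0.
have S0' : map_poly e S = 0 by apply/eqP; rewrite same_kernel_map_poly S0.
have := congr1 (fun p => (map_poly e p).[c]) PE.
rewrite rmorphD rmorphM /= map_polyZ /= hornerZ hornerD hornerM S0' horner0.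
rewrite N0 mulr0 addr0 rmorphXn => /eqP; rewrite mulf_eq0 expf_eq0.
by rewrite (negPf leadN') andbF /= => /eqP.
Qed.

Lemma same_kernel_transcendental c c' : transcendental e c ->
  transcendental f c' -> same_kernel (ext_eval e c) (ext_eval f c').
Proof.
move=> tr tr' P; apply/eqP/eqP; rewrite /= => P0.
  have /eqP := tr _ P0; rewrite same_kernel_map_poly => /eqP fP0.
  by rewrite ext_evalE fP0 horner0.
have /eqP := tr' _ P0; rewrite -same_kernel_map_poly => /eqP fP0.
by rewrite ext_evalE fP0 horner0.
Qed.

End SameKernel.

(** * Embeddings into an uncountable algebraically closed field *)

Section Uncountable.
Variable F : closedFieldType.
Hypothesis uncF : forall u : nat -> F, exists c, forall n, u n != c.

(** By [code] the ring [A] is countable, so the nonzero polynomials over [e A] have countably many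
    roots in all; [c] avoids these and [s]. *)
Lemma transcendental_exists (A : comNzRingType) (code : A -> nat)
    (e : {rmorphism A -> F}) (s : seq F) : injective code ->
  exists c, transcendental e c /\ c \notin s.
Proof.
move=> code_inj; pose rts (p : {poly F}) := sval (closed_field_poly_normal p).
have rtsP (p : {poly F}) x : p != 0 -> p.[x] = 0 -> x \in rts p.
  move=> p0 /eqP; rewrite /rts; case: closed_field_poly_normal => r /= pE.
  by rewrite {1}pE hornerZ mulf_eq0 lead_coef_eq0 (negPf p0) -root_prod_XsubC.
pose pcode (P : {poly A}) := pickle (map code P).
have pcode_inj : injective pcode.
  move=> P Q /(pcan_inj pickleK) /(inj_map code_inj) PQ; exact/val_inj.
pose dec k : {poly A} := if pselect (exists P, pcode P = k) is left exP
  then projT1 (cid exP) else 0.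
have decK P : dec (pcode P) = P.
  rewrite /dec; case: pselect => [exP|[]]; last by exists P.
  by apply: pcode_inj; case: cid.
(* [u] lists the elements of [s] and the roots of every polynomial; the default value 0 merely
   excludes one more point. *)
pose u n : F := if unpickle n is Some (k, m)
  then nth 0 (s ++ rts (map_poly e (dec k))) m else 0.
have [c cP] := uncF u; exists c.
have cNs P : c \notin s ++ rts (map_poly e P).
  apply/negP => cs; have := cP (pickle (pcode P, index c (s ++ rts (map_poly e P)))).
  by rewrite /u pickleK decK nth_index // eqxx.
split=> [P P0|]; last by have := cNs 0; rewrite mem_cat negb_or => /andP[].
apply/eqP/negPn/negP => Pn0; have := cNs P.
by rewrite mem_cat (rtsP _ _ Pn0 P0) orbT.
Qed.

(** Elements are adjoined one by one, as for derivations. Each is sent to a root of its transported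
    minimal relation or, failing such a relation, to a transcendental element; countability passes
    to [{poly A}]. *)
Lemma lift_embedding (s : seq F) (A : comNzRingType) (code : A -> nat)
    (e f : {rmorphism A -> F}) : injective code -> same_kernel e f ->
  exists (B : comNzRingType) (j : {rmorphism A -> B}) (e' f' : {rmorphism B -> F})
    (l : F -> B),
  [/\ same_kernel e' f', forall a, e' (j a) = e a, forall a, f' (j a) = f a
    & {in s, cancel l e'}].
Proof.
elim: s A code e f => [|c s IHs] A code e f code_inj kerE.
  by exists A, idfun, e, f, (fun=> 0); split.
have [c' kerE'] : exists c', same_kernel (ext_eval e c) (ext_eval f c').
  have [tr|[M minM]] := minimal_relation_exists e c.
    have [c' [tr' _]] := transcendental_exists f [::] code_inj.
    by exists c'; apply: same_kernel_transcendental.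
  have /closed_rootP[c' M0'] : size (map_poly f M) != 1.
    have [leadM _ _] := minM; rewrite size_map_poly_id0 -?kerE //.
    by rewrite neq_ltn (size_minimal_relation_gt1 minM) orbT.
  by exists c'; apply: (same_kernel_root kerE minM); apply/eqP.
have pcode_inj : injective (fun P : {poly A} => pickle (map code P)).
  move=> P Q /(pcan_inj pickleK) /(inj_map code_inj) PQ; exact/val_inj.
have [B [j [e' [f' [l [kerE'' ej fj le]]]]]] := IHs _ _ _ _ pcode_inj kerE'.
exists B, (j \o polyC), e', f', (fun x => if x == c then j 'X else l x).
split=> // [a|a|x].
- exact: etrans (ej _) (ext_evalC _ _ _).
- exact: etrans (fj _) (ext_evalC _ _ _).
rewrite inE; case: eqP => [-> _|_ /=]; first exact: etrans (ej _) (ext_evalX _ _).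
exact: le.
Qed.

End Uncountable.

(** * Frameworks and their squared distances *)

Section RationalEvaluation.

Lemma rmorph_mmap n (R : nzRingType) (S T : comNzRingType)
    (f : {rmorphism R -> S}) (g : {rmorphism S -> T}) (h : 'I_n -> S) P :
  g (mmap f h P) = mmap (g \o f) (g \o h) P.
Proof.
rewrite /mmap rmorph_sum; apply: eq_bigr => m _; rewrite rmorphM /=.
by rewrite /mmap1 rmorph_prod; congr (_ * _); apply: eq_bigr => i _; rewrite rmorphXn.
Qed.

Lemma eq_mmap n (R : nzRingType) (S : comNzRingType) (f g : R -> S)
    (h h' : 'I_n -> S) P : f =1 g -> h =1 h' -> mmap f h P = mmap g h' P.
Proof.
move=> fg hh; rewrite /mmap; apply: eq_bigr => m _; rewrite fg; congr (_ * _).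
exact: mmap1_eq.
Qed.

Definition qeval (F : numFieldType) n (h : 'I_n -> F) : {mpoly rat[n]} -> F :=
  mmap ratr h.

HB.instance Definition _ (F : numFieldType) n (h : 'I_n -> F) :=
  GRing.RMorphism.copy (qeval h) (mmap ratr h).

Lemma qevalX (F : numFieldType) n (h : 'I_n -> F) i : qeval h 'X_i = h i.
Proof. by rewrite /qeval mmapX mmap1U. Qed.

Lemma qevalC (F : numFieldType) n (h : 'I_n -> F) c : qeval h c%:MP = ratr c.
Proof. by rewrite /qeval mmapC. Qed.

Lemma meval_map_ratr (F : numFieldType) n (h : 'I_n -> F) P :
  (map_mpoly ratr P).@[h] = qeval h P.
Proof.
rewrite /map_mpoly rmorph_mmap; apply: eq_mmap => x /=; first by rewrite mevalC.
by rewrite mevalXU.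
Qed.

Lemma qeval_comp (F : numFieldType) n m (h : 'I_n -> F)
    (g : 'I_m -> {mpoly rat[n]}) P :
  qeval h (mmap (mpolyC n (R := rat)) g P) = qeval (qeval h \o g) P.
Proof. by rewrite rmorph_mmap; apply: eq_mmap => // x; apply: qevalC. Qed.

Lemma eq_qeval (F : numFieldType) n (h h' : 'I_n -> F) :
  h =1 h' -> qeval h =1 qeval h'.
Proof. by move=> hh P; apply: eq_mmap. Qed.

Definition alg_independent (F : numFieldType) n (h : 'I_n -> F) :=
  forall P : {mpoly rat[n]}, qeval h P = 0 -> P = 0.

(** Independence leaves no relation to respect, so the value [mu i] at [h i] can be prescribed
    freely. *)
Lemma qeval_derivation (F : numFieldType) n (h mu : 'I_n -> F) :
  alg_independent h ->
  eval_derivation (qeval h) (fun P => \sum_i mu i * qeval h P^`M(i)).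
Proof.
move=> ind; split=> [P Q|P Q|P /ind ->].
- by rewrite -big_split; apply: eq_bigr => i _; rewrite mderivD rmorphD mulrDr.
- rewrite mulr_sumr mulr_suml -big_split; apply: eq_bigr => i _ /=.
  by rewrite mderivM rmorphD !rmorphM /=; ring.
- by rewrite big1 // => i _; rewrite mderiv0 rmorph0 mulr0.
Qed.

Lemma map_poly_zero (A B : nzRingType) (P : {poly A}) :
  map_poly (fun=> 0 : B) P = 0.
Proof. by apply/polyP => i; rewrite coef_map_id0 // coef0. Qed.

Lemma eval_derivation_zero (A : comNzRingType) (F : fieldType)
    (e : {rmorphism A -> F}) : eval_derivation e (fun=> 0).
Proof. by split=> // *; rewrite ?mulr0 ?mul0r addr0. Qed.

Lemma eval_derivation_mmap (A : comNzRingType) (F : fieldType)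
    (e : {rmorphism A -> F}) (D : A -> F) n (f : {rmorphism rat -> A})
    (h : 'I_n -> A) P :
  eval_derivation e D -> (forall c, D (f c) = 0) -> (forall i, D (h i) = 0) ->
  D (mmap f h P) = 0.
Proof.
move=> derD Df Dh.
have DM a b : D a = 0 -> D b = 0 -> D (a * b) = 0.
  by move=> Da Db; rewrite (eval_derivationM derD) Da Db mulr0 mul0r addr0.
rewrite /mmap (eval_derivation_sum derD) big1 // => m _; apply: (DM) => //.
rewrite /mmap1; apply: (big_ind (fun x => D x = 0)) => [|*|i _].
- exact: eval_derivation1 derD.
- exact: DM.
by elim: (m i) => [|k IHk]; rewrite ?(eval_derivation1 derD) // exprS; apply: (DM).
Qed.

End RationalEvaluation.

Definition dot (F : nzRingType) d (x y : 'cV[F]_d) : F :=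
  \sum_(i < d) x i 0 * y i 0.

Definition sqdists (F : nzRingType) (V : finType) d (p : V -> 'cV[F]_d)
  (i : 'I_#|{: V * V}|) : F := sqnorm (p (enum_val i).1 - p (enum_val i).2).

(* Each edge is listed once, oriented by the enumeration of the vertices. *)
Definition edges (V : finType) (E : rel V) : {set V * V} :=
  [set e | E e.1 e.2 && (enum_rank e.1 < enum_rank e.2)%N].

Definition edge_values (F : nzRingType) (V : finType) (E : rel V) d
  (p : V -> 'cV[F]_d) (i : 'I_#|edges E|) : F :=
  sqdists p (enum_rank (enum_val i)).
Arguments edge_values {F V} E {d} p i.

(** * The differential of the edge-length map *)

Section Frameworks.
Variables (F : numFieldType) (V : finType) (E : rel V) (d : nat).
Hypotheses (Esym : ssrbool.symmetric E) (Eirr : ssrbool.irreflexive E).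
Implicit Types p q u : V -> 'cV[F]_d.

Lemma edge_valuesE p i : edge_values E p i =
  sqnorm (p (enum_val i).1 - p (enum_val i).2).
Proof. by rewrite /edge_values /sqdists enum_rankK. Qed.

Lemma edge_index (T : Type) (g h : V -> V -> T) :
  (forall a b, g a b = g b a) -> (forall a b, h a b = h b a) ->
  (forall i : 'I_#|edges E|, g (enum_val i).1 (enum_val i).2 =
     h (enum_val i).1 (enum_val i).2) ->
  forall a b, E a b -> g a b = h a b.
Proof.
move=> gC hC gh a b Eab.
have gh' x y : E x y -> (enum_rank x < enum_rank y)%N -> g x y = h x y.
  move=> Exy xy; have xyE : (x, y) \in edges E by rewrite inE Exy.
  by have := gh (enum_rank_in xyE (x, y)); rewrite enum_rankK_in.
case: (ltngtP (enum_rank a) (enum_rank b)) => [|ba|/val_inj/enum_rank_inj ab].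
- exact: gh'.
- by rewrite gC hC gh' // Esym.
- by rewrite ab Eirr in Eab.
Qed.

Lemma edge_valP (i : 'I_#|edges E|) : E (enum_val i).1 (enum_val i).2.
Proof. by have := enum_valP i; rewrite inE => /andP[]. Qed.

Lemma dotNN (x y : 'cV[F]_d) : dot (- x) (- y) = dot x y.
Proof. by apply: eq_bigr => i _; rewrite !mxE mulrNN. Qed.

Lemma sqnormN (x : 'cV[F]_d) : sqnorm (- x) = sqnorm x.
Proof. by apply: eq_bigr => i _; rewrite mxE sqrrN. Qed.

Lemma sqdistC p a b : sqnorm (p a - p b) = sqnorm (p b - p a).
Proof. by rewrite -sqnormN opprB. Qed.

Lemma equivalentP p q :
  equivalent E p q <-> edge_values E p =1 edge_values E q.
Proof.
split=> [pq i|pq a b Eab]; first by rewrite !edge_valuesE pq ?edge_valP.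
have gC (r : V -> 'cV[F]_d) x y : sqnorm (r x - r y) = sqnorm (r y - r x).
  exact: sqdistC.
apply: (edge_index (gC p) (gC q)) Eab => i.
by rewrite -!edge_valuesE pq.
Qed.

Definition point_entries p : seq F := [seq p vi.1 vi.2 0 | vi : V * 'I_d].

Lemma point_entriesP p v i : p v i 0 \in point_entries p.
Proof. by apply/mapP; exists (v, i); rewrite ?mem_enum. Qed.

Lemma eval_derivation_sqnorm (A : comNzRingType) (e : {rmorphism A -> F})
    (D : A -> F) (x y : 'cV[A]_d) : eval_derivation e D ->
  D (sqnorm (x - y)) =
    dot (map_mx e x - map_mx e y) (map_mx D x - map_mx D y) *+ 2.
Proof.
move=> derD; rewrite /sqnorm (eval_derivation_sum derD) /dot -sumrMnl.
apply: eq_bigr => i _; rewrite expr2 (eval_derivationM derD) !mxE.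
by rewrite (eval_derivationB derD) rmorphB /=; ring.
Qed.

Lemma rmorph_sqnorm (A B : comNzRingType) (e : {rmorphism A -> B})
    (x y : 'cV[A]_d) : e (sqnorm (x - y)) = sqnorm (map_mx e x - map_mx e y).
Proof.
by rewrite /sqnorm rmorph_sum; apply: eq_bigr => i _; rewrite !mxE rmorphXn rmorphB.
Qed.

Lemma map_lift (A : Type) (e : A -> F) (l : F -> A) p v :
  {in point_entries p, cancel l e} -> map_mx e (map_mx l (p v)) = p v.
Proof.
by move=> le; apply/colP => i; rewrite !mxE le // point_entriesP.
Qed.

(** A derivation [D] with prescribed values on the edge values is extended to the coordinates of
    [q]; the velocity is [D q]. As [D] of a squared length is twice a dot product, [nu] is twice
    [mu]. *)
Lemma rigidity_surjective q (mu : 'I_#|edges E| -> F) :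
  alg_independent (edge_values E q) ->
  exists u, forall i, dot (q (enum_val i).1 - q (enum_val i).2)
    (u (enum_val i).1 - u (enum_val i).2) = mu i.
Proof.
move=> ind; pose nu i := mu i *+ 2.
have [B [j [e [D [l [derD ej Dj le]]]]]] :=
  lift_derivation (@pchar_num F) (point_entries q) (qeval_derivation nu ind).
exists (fun v => map_mx D (map_mx l (q v))) => i.
set a := (enum_val i).1; set b := (enum_val i).2.
have : e (sqnorm (map_mx l (q a) - map_mx l (q b))) = e (j 'X_i).
  by rewrite rmorph_sqnorm !map_lift // ej /= qevalX edge_valuesE.
move/(eval_derivation_eq derD); rewrite (eval_derivation_sqnorm _ _ derD) Dj.
rewrite (bigD1 i) //= big1 => [|k ki]; last first.
  by rewrite mderivX mnm1E eq_sym (negPf ki) scale0r rmorph0 mulr0.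
rewrite mderivX mnm1E eqxx scale1r -{1}[U_(i)%MM]add0m addmK mpolyX0 rmorph1.
rewrite mulr1 addr0 /nu !(map_lift _ le) => /eqP.
by rewrite -subr_eq0 -mulrnBl mulrn_eq0 /= subr_eq0 => /eqP.
Qed.

Lemma rigidity_surjective_sym q (mu : V -> V -> F) :
  alg_independent (edge_values E q) -> (forall a b, mu a b = mu b a) ->
  exists u, forall a b, E a b -> dot (q a - q b) (u a - u b) = mu a b.
Proof.
move=> ind muC; have [u uE] := rigidity_surjective
  (fun i => mu (enum_val i).1 (enum_val i).2) ind.
by exists u; apply: edge_index => // a b; rewrite -dotNN !opprB.
Qed.

(** Trivial motions are recognised by their preserving all squared distances to first order, so no
    infinitesimal isometry has to be exhibited. *)
Definition infinitesimally_rigid p := forall u,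
  (forall a b, E a b -> dot (p a - p b) (u a - u b) = 0) ->
  forall a b, dot (p a - p b) (u a - u b) = 0.

(** Otherwise some derivation kills the edge values and is 1 at the value of [G]. Extended to the
    coordinates of [p], it is a velocity preserving the edges, hence all distances, to first order;
    so it kills the value of [G] too. *)
Lemma algebraic_over_edge_values p (G : {mpoly rat[#|{: V * V}|]}) :
  infinitesimally_rigid p ->
  ~ transcendental (qeval (edge_values E p)) (qeval (sqdists p) G).
Proof.
move=> rigp tr.
have der1 := eval_derivation_transcendental (eval_derivation_zero _) 1 tr.
have [B [j [e [D [l [derD ej Dj le]]]]]] :=
  lift_derivation (@pchar_num F) (point_entries p) der1.
pose X v := map_mx l (p v).
have eX v : map_mx e (X v) = p v by rewrite map_lift.
have Dconst a : D (j a%:P) = 0.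
  by rewrite Dj (poly_derivationC (eval_derivation_zero _)).
have edge0 a b : E a b -> dot (p a - p b) (map_mx D (X a) - map_mx D (X b)) = 0.
  move: a b; apply: edge_index => [a b|//|i]; first by rewrite -dotNN !opprB.
  set a := (enum_val i).1; set b := (enum_val i).2.
  have : e (sqnorm (X a - X b)) = e (j ('X_i)%:P).
    rewrite rmorph_sqnorm !eX ej.
    by apply/esym/(etrans (ext_evalC _ _ _)); rewrite /= qevalX edge_valuesE.
  move/(eval_derivation_eq derD); rewrite Dconst (eval_derivation_sqnorm _ _ derD).
  by rewrite !eX => /eqP; rewrite mulrn_eq0 /= => /eqP.
have all0 := rigp _ edge0.
pose f := j \o polyC \o mpolyC _ (R := rat).
have DG0 : D (mmap f (sqdists X) G) = 0.
  apply: (eval_derivation_mmap _ derD) => [c|i]; first exact: Dconst.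
  by rewrite /sqdists (eval_derivation_sqnorm _ _ derD) !eX all0 mul0rn.
have : e (mmap f (sqdists X) G) = e (j 'X).
  rewrite rmorph_mmap; apply/esym/(etrans (ej _)).
  apply/(etrans (ext_evalX _ _))/esym/eq_mmap => x.
    exact: etrans (ej _) (etrans (ext_evalC _ _ _) (qevalC _ _)).
  by rewrite /= /sqdists rmorph_sqnorm !eX.
move/(eval_derivation_eq derD); rewrite DG0 Dj /poly_derivation.
rewrite map_polyX derivX hornerC mulr1.
by rewrite map_poly_zero horner0 add0r => /eqP; rewrite eq_sym oner_eq0.
Qed.

End Frameworks.

(** * Transfer of identities from generic realisations *)

Section Transfer.
Variables (V : finType) (d : nat).

Definition universal_point (v : V) : 'cV[{mpoly rat[#|{: V * 'I_d}|]}]_d :=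
  \col_i 'X_(enum_rank (v, i)).

Lemma coordsE (F : nzRingType) (p : V -> 'cV[F]_d) v i :
  coords p (enum_rank (v, i)) = p v i 0.
Proof. by rewrite /coords enum_rankK. Qed.

Lemma qeval_universal (F : numFieldType) (p : V -> 'cV[F]_d) :
  qeval (coords p) \o sqdists universal_point =1 sqdists p.
Proof.
move=> i; rewrite /= /sqdists rmorph_sqnorm.
by congr (sqnorm (_ - _)); apply/colP => j; rewrite !mxE /= qevalX coordsE.
Qed.

(** A relation between squared distances at a generic realisation is an identity in the coordinates,
    so it holds at every realisation, also over another field. *)
Lemma generic_transfer (F F' : numFieldType) (p : V -> 'cV[F]_d)
    (q : V -> 'cV[F']_d) (P : {mpoly rat[#|{: V * V}|]}) :
  generic p -> qeval (sqdists p) P = 0 -> qeval (sqdists q) P = 0.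
Proof.
move=> gp; rewrite -(eq_qeval (qeval_universal p)) -qeval_comp => P0.
have {}P0 : mmap (mpolyC _ (R := rat)) (sqdists universal_point) P = 0.
  by apply/eqP/contraT => /gp; rewrite meval_map_ratr P0 eqxx.
by rewrite -(eq_qeval (qeval_universal q)) -qeval_comp P0 rmorph0.
Qed.

Variable E : rel V.

Definition edge_poly (P : {mpoly rat[#|edges E|]}) : {mpoly rat[#|{: V * V}|]} :=
  mmap (mpolyC _ (R := rat)) (fun i => 'X_(enum_rank (enum_val i))) P.
HB.instance Definition _ := GRing.RMorphism.copy edge_poly
  (mmap (mpolyC _ (R := rat)) (fun i => 'X_(enum_rank (enum_val i)))).

Lemma qeval_edge_poly (F : numFieldType) (p : V -> 'cV[F]_d) P :
  qeval (sqdists p) (edge_poly P) = qeval (edge_values E p) P.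
Proof. by rewrite qeval_comp; apply: eq_qeval => i; rewrite /= qevalX. Qed.

Lemma qeval_relation (F : numFieldType) (p : V -> 'cV[F]_d)
    (a : {poly {mpoly rat[#|edges E|]}}) G :
  qeval (sqdists p) (map_poly edge_poly a).[G] =
  (map_poly (qeval (edge_values E p)) a).[qeval (sqdists p) G].
Proof.
rewrite -horner_map /= -map_poly_comp; congr (_.[_]).
by apply: eq_map_poly => P; exact: qeval_edge_poly.
Qed.

Lemma generic_edge_transfer (F F' : numFieldType) (p : V -> 'cV[F]_d)
    (q : V -> 'cV[F']_d) (P : {mpoly rat[#|edges E|]}) :
  generic p -> qeval (edge_values E p) P = 0 -> qeval (edge_values E q) P = 0.
Proof. by move=> gp; rewrite -!qeval_edge_poly; exact: generic_transfer. Qed.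

Lemma generic_relation_transfer (F F' : numFieldType) (p : V -> 'cV[F]_d)
    (q : V -> 'cV[F']_d) (a : {poly {mpoly rat[#|edges E|]}}) G :
  generic p ->
  (map_poly (qeval (edge_values E p)) a).[qeval (sqdists p) G] = 0 ->
  (map_poly (qeval (edge_values E q)) a).[qeval (sqdists q) G] = 0.
Proof. by move=> gp; rewrite -!qeval_relation; exact: generic_transfer. Qed.

End Transfer.

(** * Algebraic dependence detected by a partial derivative *)

Section MinimalDependence.
Variables (F : numFieldType) (n : nat) (h : 'I_n -> F).

Lemma mderiv_eq0 (P : {mpoly rat[n]}) :
  (forall j, P^`M(j) = 0) -> P = (P@_0)%:MP.
Proof.
move=> P0; apply/mpolyP => m; rewrite mcoeffC.
have [<-|m0] := eqVneq 0%MM m; first by rewrite mulr1.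
rewrite mulr0; have /existsP[j mj] : [exists j, m j != 0%N].
  rewrite -negb_forall; apply: contraNN m0 => /forallP m0.
  by apply/eqP/mnmP => j; rewrite mnm0E (eqP (m0 j)).
have := mcoeff_deriv j (m - U_(j))%MM P; rewrite P0 mcoeff0.
rewrite submK ?lep1mP // => /esym/eqP; rewrite mulrn_eq0 /= => /eqP //.
Qed.

Lemma msize_mderiv (P : {mpoly rat[n]}) j : P != 0 -> (msize P^`M(j) < msize P)%N.
Proof.
move=> P0; have sP : (0 < msize P)%N by rewrite lt0n msize_poly_eq0.
rewrite -(prednK sP) ltnS msizeE; apply/bigmax_leqP_seq => m + _.
rewrite mcoeff_msupp mcoeff_deriv => Pm.
have : (m + U_(j))%MM \in msupp P.
  by rewrite mcoeff_msupp; apply: contraNneq Pm => ->; rewrite mul0rn.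
by move/msize_mdeg_lt; rewrite mdegD mdeg1 addn1 -[in X in (_ < X)%N](prednK sP) ltnS.
Qed.

Definition line_poly (j : 'I_n) : {mpoly rat[n]} -> {poly F} :=
  mmap (polyC \o ratr) (fun i => if i == j then 'X else (h i)%:P).
HB.instance Definition _ j := GRing.RMorphism.copy (line_poly j)
  (mmap (polyC \o ratr) (fun i => if i == j then 'X else (h i)%:P)).

Lemma line_polyC j c : line_poly j c%:MP = (ratr c)%:P.
Proof. by rewrite /line_poly mmapC. Qed.

Lemma line_polyX j i : line_poly j 'X_i = if i == j then 'X else (h i)%:P.
Proof. by rewrite /line_poly mmapX mmap1U. Qed.

Lemma horner_line_poly j P t :
  (line_poly j P).[t] = qeval (fun i => if i == j then t else h i) P.
Proof.
rewrite -[LHS]/(horner_eval t (line_poly j P)) rmorph_mmap.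
apply: eq_mmap => x /=; first by rewrite /horner_eval hornerC.
by rewrite /horner_eval; case: eqP; rewrite ?hornerX ?hornerC.
Qed.

Lemma deriv_line_poly j P : (line_poly j P)^`() = line_poly j P^`M(j).
Proof.
pose good Q := (line_poly j Q)^`() = line_poly j Q^`M(j).
have gM A B : good A -> good B -> good (A * B).
  by move=> IA IB; rewrite /good mderivM rmorphM rmorphD !rmorphM derivM IA IB.
have gC c : good c%:MP by rewrite /good mderivC rmorph0 line_polyC derivC.
have gD A B : good A -> good B -> good (A + B).
  by move=> IA IB; rewrite /good mderivD !rmorphD derivD IA IB.
rewrite [P]mpolyE; apply: (big_ind good) => [|//|m _]; first exact: gC 0.
rewrite -mul_mpolyC; apply: (gM) => //; rewrite mpolyXE_id.
apply: (big_ind good) => [|//|i _]; first exact: gC 1.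
elim: (m i) => [|k IHk]; first exact: gC 1.
rewrite exprS; apply: (gM) => //.
rewrite /good mderivX line_polyX mnm1E.
case: eqP => [->|_]; last by rewrite scale0r rmorph0 derivC.
by rewrite derivX scale1r -{1}[U_(j)%MM]add0m addmK mpolyX0 rmorph1.
Qed.

(** A relation of least degree is not constant, so some partial derivative is nonzero; having
    smaller degree, that derivative is not a relation. *)
Lemma minimal_dependence : ~ alg_independent h -> exists (P : {mpoly rat[n]}) j,
  qeval h P = 0 /\ qeval h P^`M(j) != 0.
Proof.
move=> /existsNP[P1 /not_implyP[P1h P1n]].
pose good s := `[< exists P, [/\ msize P = s, qeval h P = 0 & P != 0] >].
have exg : exists s, good s.
  by exists (msize P1); apply/asboolP; exists P1; split=> //; apply/eqP.
case: (ex_minnP exg) => s /asboolP[P [sP Ph Pn]] smin.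
have /existsNP[j Pj] : ~ forall j, P^`M(j) = 0.
  move/mderiv_eq0 => PE; move: Ph Pn; rewrite PE qevalC => /eqP.
  by rewrite fmorph_eq0 => /eqP ->; rewrite eqxx.
exists P, j; split=> //; apply: contra_notN Pj => /eqP Pj0.
apply/eqP/contraT => Pjn; have /smin : good (msize P^`M(j)).
  by apply/asboolP; exists P^`M(j).
by rewrite -sP leqNgt msize_mderiv.
Qed.

End MinimalDependence.

(** * Real rigid frameworks *)

Section Congruence.
Variables (F : fieldType) (V : finType) (d : nat).

Lemma sqnormE (x : 'cV[F]_d) : sqnorm x = dot x x.
Proof. by apply: eq_bigr => i _; rewrite expr2. Qed.

Lemma dotE (x y : 'cV[F]_d) : dot x y = (x^T *m y) 0 0.
Proof. by rewrite mxE; apply: eq_bigr => i _; rewrite mxE. Qed.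

Lemma dotC (x y : 'cV[F]_d) : dot x y = dot y x.
Proof. by apply: eq_bigr => i _; rewrite mulrC. Qed.

Lemma dotDl (x y z : 'cV[F]_d) : dot (x + y) z = dot x z + dot y z.
Proof. by rewrite !dotE linearD /= mulmxDl mxE. Qed.

Lemma dotDr (x y z : 'cV[F]_d) : dot z (x + y) = dot z x + dot z y.
Proof. by rewrite dotC dotDl !(dotC z). Qed.

Lemma dotNr (x z : 'cV[F]_d) : dot z (- x) = - dot z x.
Proof. by rewrite !dotE mulmxN mxE. Qed.

Lemma dotZl c (x z : 'cV[F]_d) : dot (c *: x) z = c * dot x z.
Proof. by rewrite !dotE linearZ /= -scalemxAl mxE. Qed.

Lemma dotZr c (x z : 'cV[F]_d) : dot z (c *: x) = c * dot z x.
Proof. by rewrite dotC dotZl dotC. Qed.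

Lemma dot_sumr (I : Type) (r : seq I) (P : pred I) (x : I -> 'cV[F]_d) z :
  dot z (\sum_(i <- r | P i) x i) = \sum_(i <- r | P i) dot z (x i).
Proof.
by apply: (big_morph _ (fun x y => dotDr x y z)); rewrite dotE mulmx0 mxE.
Qed.

Lemma dot_suml (I : Type) (r : seq I) (P : pred I) (x : I -> 'cV[F]_d) z :
  dot (\sum_(i <- r | P i) x i) z = \sum_(i <- r | P i) dot (x i) z.
Proof. by rewrite dotC dot_sumr; apply: eq_bigr => i _; rewrite dotC. Qed.

Lemma sqnormD (x y : 'cV[F]_d) :
  sqnorm (x + y) = sqnorm x + dot x y *+ 2 + sqnorm y.
Proof. by rewrite !sqnormE dotDl !dotDr (dotC y x); ring. Qed.

Lemma dot_orthogonal (A : 'M[F]_d) x y : A^T *m A = 1%:M ->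
  dot (A *m x) (A *m y) = dot x y.
Proof. by move=> AA; rewrite !dotE trmx_mul -mulmxA (mulmxA A^T) AA mul1mx. Qed.

Lemma congruent_sqdist (p q : V -> 'cV[F]_d) a b : congruent p q ->
  sqnorm (q a - q b) = sqnorm (p a - p b).
Proof.
move=> [A [c [AA _ qE]]].
rewrite !qE opprD addrACA subrr addr0 -mulmxBr !sqnormE.
exact: dot_orthogonal.
Qed.

Lemma congruent_sym (p q : V -> 'cV[F]_d) : congruent p q -> congruent q p.
Proof.
move=> [A [c [AA AA' qE]]]; exists A^T, (- A^T *m c); split; rewrite ?trmxK //.
by move=> v; rewrite qE mulmxDr mulmxA AA mul1mx mulNmx addrK.
Qed.

Lemma congruent_trans (p q r : V -> 'cV[F]_d) :
  congruent p q -> congruent q r -> congruent p r.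
Proof.
move=> [A [c [AA AA' qE]]] [B [e [BB BB' rE]]].
exists (B *m A), (B *m c + e); split.
- by rewrite trmx_mul -mulmxA (mulmxA B^T) BB mul1mx.
- by rewrite trmx_mul -mulmxA (mulmxA A) AA' mul1mx.
- by move=> v; rewrite rE qE mulmxDr mulmxA addrA.
Qed.

Lemma congruent_refl (p : V -> 'cV[F]_d) : congruent p p.
Proof.
exists 1%:M, 0; split; rewrite ?trmx1 ?mulmx1 // => v.
by rewrite mul1mx addr0.
Qed.

End Congruence.

Lemma isolated_root (R : realFieldType) (b : {poly R}) c : b != 0 ->
  exists eta, 0 < eta /\ forall y, root b y -> `|y - c| < eta -> y = c.
Proof.
have [n] := ubnP (size b); elim: n => // n IHn in b *; rewrite ltnS => sb b0.
have [[y [by0 yc]]|noroot] := EM (exists y, root b y /\ y <> c); last first.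
  exists 1; split=> // y by0 _; apply: contrapT => yc.
  by apply: noroot; exists y.
have [b1 bE] := factor_theorem _ _ by0.
have b10 : b1 != 0 by apply: contraNneq b0 => b10; rewrite bE b10 mul0r.
have [|//|eta [eta0 etaP]] := IHn b1.
  move: sb; rewrite bE size_Mmonic ?monicXsubC // size_XsubC addn2 /=.
  by apply: leq_trans.
exists (Num.min eta `|y - c|); split.
  by rewrite lt_min eta0 normr_gt0 subr_eq0; apply/eqP.
move=> z; rewrite bE rootM lt_min root_XsubC => /orP[zb /andP[ze _]|].
  exact: etaP.
by move=> /eqP -> /andP[_]; rewrite ltxx.
Qed.

Lemma sqdist_continuous (R : realFieldType) (V : finType) d
    (p : V -> 'cV[R]_d) a b (eta : R) : 0 < eta ->
  exists eps, 0 < eps /\ forall q : V -> 'cV[R]_d,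
    (forall v i, `|q v i 0 - p v i 0| < eps) ->
    `|sqnorm (q a - q b) - sqnorm (p a - p b)| < eta.
Proof.
move=> eta0; pose M := 1 + \sum_(i < d) `|p a i 0 - p b i 0|.
have M1 : 1 <= M by rewrite lerDl sumr_ge0.
have M0 : 0 < M := lt_le_trans ltr01 M1.
have Mi i : `|p a i 0 - p b i 0| <= M.
  by rewrite /M (bigD1 i) //= addrCA lerDl addr_ge0 // sumr_ge0.
have d0 : 0 < d.+1%:R :> R by rewrite ltr0n.
(* The first bound yields [|x + y| <= 3 * M] below; the second makes [d] terms of size at most
   [eps * (6 * M)] add up to less than [eta], where [d.+1] keeps the divisor nonzero and the
   inequality strict. *)
pose eps := Num.min (M / 2) (eta / (6 * M * d.+1%:R)).
have eps0 : 0 < eps by rewrite lt_min !divr_gt0 // !mulr_gt0 // ltr0n.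
have epsM : eps * 2 <= M by rewrite -ler_pdivlMr // ge_min lexx.
have epsd : eps * (6 * M * d.+1%:R) <= eta.
  by rewrite -ler_pdivlMr ?ge_min ?lexx ?orbT // !mulr_gt0 // ltr0n.
exists eps; split=> // q qp.
have term i : `|(q a i 0 - q b i 0) ^+ 2 - (p a i 0 - p b i 0) ^+ 2| <= eps * (6 * M).
  set y := p a i 0 - p b i 0; set x := q a i 0 - q b i 0.
  have xy : `|x - y| <= eps * 2.
    have -> : x - y = (q a i 0 - p a i 0) - (q b i 0 - p b i 0) by rewrite /x /y; ring.
    apply: le_trans (ler_normB _ _) _; have := qp a i; have := qp b i; lra.
  rewrite subr_sqr normrM.
  have xy' : `|x + y| <= 3 * M.
    have -> : x + y = (x - y) + (y + y) by ring.
    apply: le_trans (ler_normD _ _) _.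
    have := ler_normD y y; have := Mi i; rewrite -/y; lra.
  have -> : eps * (6 * M) = (eps * 2) * (3 * M) by ring.
  by apply: ler_pM.
rewrite /sqnorm -sumrB; apply: le_lt_trans (ler_norm_sum _ _ _) _.
apply: (@le_lt_trans _ _ (\sum_(i < d) eps * (6 * M))).
  by apply: ler_sum => i _; rewrite !mxE.
rewrite sumr_const card_ord -[ltLHS]mulr_natr.
apply: lt_le_trans epsd; rewrite [ltRHS]mulrA.
by rewrite ltr_pM2l ?ltr_nat // !mulr_gt0.
Qed.

(** * Independence and infinitesimal rigidity from rigidity *)

Section RealRigidity.
Variables (R : realType) (V : finType) (E : rel V) (d : nat).
Hypotheses (Esym : ssrbool.symmetric E) (Eirr : ssrbool.irreflexive E).
Variable p : V -> 'cV[R]_d.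
Hypotheses (gp : generic p) (rp : rigid_framework E p).

(** A relation [P] with nonzero derivative at edge [j] holds at every realisation by genericity.
    With the other edge values fixed, the value of [j] is an isolated root, so near [p] edge [j] is
    preserved once the others are, and deleting it keeps rigidity. *)
Lemma minimally_rigid_independent :
  (forall u w, E u w -> ~ d_rigid R d (remove_edge E u w)) ->
  alg_independent (edge_values E p).
Proof.
move=> minE; apply: contrapT => /minimal_dependence[P [j [P0 Pj]]].
set lam := edge_values E p in P0 Pj *.
pose u := (enum_val j).1; pose w := (enum_val j).2.
apply: (minE u w (edge_valP j)); exists p; split=> //.
pose b := line_poly lam j P.
have b0 : b != 0.
  apply: contraNneq Pj => b0.
  have : (line_poly lam j P)^`().[lam j] = 0 by rewrite -/b b0 deriv0 horner0.
  rewrite deriv_line_poly horner_line_poly => Pj; apply/eqP.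
  by rewrite -{}[RHS]Pj; apply: eq_qeval => i; case: eqP => [->|].
have [eta [eta0 etaP]] := isolated_root (lam j) b0.
have [eps1 [eps10 close]] := sqdist_continuous p u w eta0.
have [eps [eps0 rigid]] := rp.
exists (Num.min eps1 eps); split; first by rewrite lt_min eps10.
move=> q pq qp.
have pq1 v i : `|q v i 0 - p v i 0| < eps1.
  by have := qp v i; rewrite lt_min => /andP[].
have pq2 v i : `|q v i 0 - p v i 0| < eps.
  by have := qp v i; rewrite lt_min => /andP[].
apply: rigid => //; apply/equivalentP => //.
have other i : i != j -> edge_values E p i = edge_values E q i.
  move=> ij; rewrite !edge_valuesE; apply: pq.
  rewrite /remove_edge edge_valP /= negb_or; apply/andP; split.
    apply: contra ij => /andP[/eqP e1 /eqP e2]; apply/eqP/enum_val_inj.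
    by rewrite [LHS]surjective_pairing e1 e2 -surjective_pairing.
  apply/negP => /andP[/eqP e1 /eqP e2].
  have := enum_valP i; have := enum_valP j; rewrite !inE e1 e2.
  by move=> /andP[_ uw] /andP[_ wu]; have := ltn_trans uw wu; rewrite ltnn.
have qj : edge_values E q j = lam j.
  apply: etaP; last by rewrite /lam !edge_valuesE; exact: close.
  apply/rootP; rewrite horner_line_poly.
  rewrite -[RHS](generic_edge_transfer q gp P0); apply: eq_qeval => i.
  by case: eqP => [->//|/eqP /other].
by move=> i; have [->|/other//] := eqVneq i j; rewrite qj.
Qed.

Hypothesis ind : alg_independent (edge_values E p).

(** Suppose that [u0] preserves the edges but not the pair [(a, b)] to first order. With this pair
    added to the edges the differential stays onto, so a small perturbation keeps all edge lengths
    exactly and changes that of the pair, against rigidity. *)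
Lemma rigid_infinitesimally_rigid : infinitesimally_rigid E p.
Proof.
move=> u0 u0E a b; apply: contrapT => /eqP gam0.
set gam := dot _ _ in gam0.
pose k := #|edges E|.
have /choice[u uE] : forall i : 'I_k, exists ui : V -> 'cV[R]_d, forall j,
    dot (p (enum_val j).1 - p (enum_val j).2)
      (ui (enum_val j).1 - ui (enum_val j).2) = (i == j)%:R.
  by move=> i; exact: (rigidity_surjective (fun j => (i == j)%:R) ind).
pose e (i : 'I_k.+1) : V * V :=
  if unlift ord_max i is Some j then enum_val j else (a, b).
pose t (j : 'I_k) := dot (p a - p b) (u j a - u j b) / gam.
(* These velocities are dual to the constraints [e l], where [ord_max] stands for the pair [(a, b)]:
   subtracting [t j *: u0] cancels the effect of [u j] on the pair without disturbing the edges. *)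
pose w (i : 'I_k.+1) (v : V) : 'cV[R]_d :=
  if unlift ord_max i is Some j then u j v - t j *: u0 v else gam^-1 *: u0 v.
have wE i l : dot (p (e l).1 - p (e l).2) (w i (e l).1 - w i (e l).2) = (i == l)%:R.
  have dotB x y z (c : R) f g : dot x (y - c *: f - (z - c *: (g : 'cV[R]_d))) =
      dot x (y - z) - c * dot x (f - g).
    have -> : y - c *: f - (z - c *: g) = (y - z) + (- c) *: (f - g).
      by apply/colP => k'; rewrite !mxE; ring.
    by rewrite dotDr dotZr mulNr.
  rewrite /w /e; case: (unliftP ord_max i) => [i'|] ->;
    case: (unliftP ord_max l) => [l'|] ->; rewrite ?eqxx /=.
  - by rewrite (inj_eq lift_inj) dotB uE u0E ?edge_valP // mulr0 subr0.
  - by rewrite dotB -/gam /t divfK // subrr eq_sym (negPf (neq_lift _ _)).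
  - by rewrite -scalerBr dotZr u0E ?edge_valP // mulr0 (negPf (neq_lift _ _)).
  - by rewrite -scalerBr dotZr -/gam mulVf.
(* Half of the quadratic term of a squared length, since the linear term carries a factor 2. *)
pose C i j l := dot (w j (e i).1 - w j (e i).2) (w l (e i).1 - w l (e i).2) / 2.
have [eps [eps0 rigid]] := rp.
pose K := 1 + \sum_i \sum_v \sum_j `|w i v j 0|.
have K1 : 1 <= K by rewrite lerDl; do 3!apply: sumr_ge0 => ? _.
have K0 : 0 < K := lt_le_trans ltr01 K1.
have wK v j : \sum_i `|w i v j 0| <= K.
  apply: (@le_trans _ _ (\sum_i \sum_v \sum_j `|w i v j 0|)); last first.
    by rewrite /K lerDr.
  apply: ler_sum => i _; rewrite (bigD1 v) //= (bigD1 j) //= -addrA lerDl.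
  by rewrite addr_ge0 ?sumr_ge0 // => *; rewrite ?sumr_ge0.
have epsK : 0 < eps / 2 / K by rewrite !divr_gt0.
have [eta [eta0 etaP]] := RealAnalysis.quadratic_perturbation C epsK.
(* The edges keep their squared lengths and that of [(a, b)] grows by [2 * eta]. *)
have [|x [xK xE]] := etaP (fun i => if i == ord_max then eta else 0).
  by move=> i; case: eqP => _; [rewrite gtr0_norm | rewrite normr0 ltW].
pose q v := p v + \sum_i x i *: w i v.
have qE i : sqnorm (q (e i).1 - q (e i).2) = sqnorm (p (e i).1 - p (e i).2) +
    (if i == ord_max then eta else 0) *+ 2.
  rewrite /q opprD addrACA -sumrB sqnormD -addrA; congr (_ + _).
  rewrite -xE mulrnDl; congr (_ *+ 2 + _).
    rewrite dot_sumr (bigD1 i) //= -scalerBr dotZr wE eqxx mulr1 big1 ?addr0 //.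
    by move=> l li; rewrite -scalerBr dotZr wE (negPf li) mulr0.
  rewrite sqnormE dot_suml -sumrMnl; apply: eq_bigr => j _.
  rewrite dot_sumr -sumrMnl; apply: eq_bigr => l _.
  by rewrite -!scalerBr dotZl dotZr /C; field.
have /(congruent_sqdist a b) : congruent p q.
  apply: rigid => [|v j].
    apply/(equivalentP Esym Eirr) => i; rewrite !edge_valuesE.
    have := qE (lift ord_max i); rewrite /e liftK eq_sym (negPf (neq_lift _ _)).
    by rewrite mul0rn addr0.
  rewrite /q mxE addrAC subrr add0r summxE.
  apply: le_lt_trans (ler_norm_sum _ _ _) _.
  apply: (@le_lt_trans _ _ (\sum_i eps / 2 / K * `|w i v j 0|)).
    by apply: ler_sum => i _; rewrite mxE normrM ler_wpM2r.
  rewrite -mulr_sumr; apply: le_lt_trans (ler_wpM2l (ltW epsK) (wK v j)) _.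
  by rewrite divfK ?gt_eqF //; lra.
have := qE ord_max; rewrite /e unlift_none eqxx /= => -> /eqP.
by rewrite -subr_eq0 addrAC subrr add0r mulrn_eq0 /= gt_eqF.
Qed.

End RealRigidity.

(** * Realisations equivalent to a generic one *)

Section Star.
Variables (V : finType) (d : nat) (x : V) (w : 'I_d -> V).

Definition star_mx (F : nzRingType) (q : V -> 'cV[F]_d) : 'M[F]_d :=
  \matrix_(i, j) (q (w j) i 0 - q x i 0).

Lemma star_mx_tr_mul (F : fieldType) (q : V -> 'cV[F]_d) y i :
  ((star_mx q)^T *m y) i 0 = dot (q (w i) - q x) y.
Proof. by rewrite mxE; apply: eq_bigr => j _; rewrite !mxE. Qed.

Lemma polarization (F : numFieldType) (y z t : 'cV[F]_d) :
  dot (y - t) (z - t) *+ 2 = sqnorm (y - t) + sqnorm (z - t) - sqnorm (y - z).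
Proof.
have -> : y - z = (y - t) - (z - t) by rewrite opprB addrA subrK.
by rewrite (sqnormD (y - t) (- (z - t))) sqnormN dotNr; ring.
Qed.

(** The determinant of twice the Gram matrix of the vectors from [x] to the [w i], written by
    polarization in terms of squared distances. *)
Definition gram_poly : {mpoly rat[#|{: V * V}|]} :=
  \det (\matrix_(i < d, j < d) ('X_(enum_rank (w i, x)) + 'X_(enum_rank (w j, x))
    - 'X_(enum_rank (w i, w j)))).

Lemma qeval_gram_poly (F : numFieldType) (q : V -> 'cV[F]_d) :
  qeval (sqdists q) gram_poly = 2 ^+ d * \det (star_mx q) ^+ 2.
Proof.
rewrite -det_map_mx expr2 -{1}(det_tr (star_mx q)) -det_mulmx -detZ; congr (\det _).
apply/matrixP => i j; rewrite !mxE rmorphB rmorphD /= !qevalX /sqdists.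
rewrite !enum_rankK /= -polarization mulr_natl; congr (_ *+ 2).
by apply: eq_bigr => k _; rewrite !mxE.
Qed.

Hypotheses (w_inj : injective w) (wx : forall i, w i != x).

Lemma generic_star_mx (F : numFieldType) (p : V -> 'cV[F]_d) :
  generic p -> \det (star_mx p) != 0.
Proof.
move=> gp; pose D := \det (star_mx (@universal_point V d)).
have DE (F' : numFieldType) (q : V -> 'cV[F']_d) :
    qeval (coords q) D = \det (star_mx q).
  rewrite -det_map_mx; congr (\det _); apply/matrixP => i j.
  by rewrite !mxE rmorphB /= !qevalX !coordsE.
rewrite -DE -meval_map_ratr; apply: gp; apply/eqP => D0.
(* With the [w i] at the standard basis and all other vertices at 0 the star matrix is the identity,
   so its determinant is not the zero polynomial. *)
pose s v : 'cV[rat]_d := \col_i (v == w i)%:R.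
have := DE _ s; rewrite D0 rmorph0.
have -> : star_mx s = 1%:M.
  apply/matrixP => i j; rewrite !mxE (inj_eq w_inj) eq_sym.
  by rewrite [x == _]eq_sym (negPf (wx _)) subr0.
by rewrite det1 => /eqP; rewrite eq_sym oner_eq0.
Qed.

(** Equal distances give equal Gram matrices, so the map [A] taking one star to the other is
    orthogonal; any vertex is determined by its dot products with the star. *)
Lemma congruent_of_sqdist (F : numFieldType) (q r : V -> 'cV[F]_d) :
  \det (star_mx q) != 0 ->
  (forall a b, sqnorm (q a - q b) = sqnorm (r a - r b)) -> congruent q r.
Proof.
move=> dq qr.
have dots a b : dot (q a - q x) (q b - q x) = dot (r a - r x) (r b - r x).
  by apply: (@pmulrnI F 2) => //; rewrite !polarization !qr.
set B := star_mx q in dq; pose B' := star_mx r.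
have gram : B'^T *m B' = B^T *m B.
  apply/matrixP => i j.
  have e (s : V -> 'cV[F]_d) : ((star_mx s)^T *m star_mx s) i j =
      dot (s (w i) - s x) (s (w j) - s x).
    by rewrite mxE; apply: eq_bigr => k _; rewrite !mxE.
  by rewrite !e dots.
have uB : B \in unitmx by rewrite unitmxE unitfE.
have uB' : B'^T \in unitmx.
  rewrite unitmx_tr unitmxE unitfE; apply: contraNneq dq => d0.
  have := congr1 determinant gram; rewrite !det_mulmx d0 mulr0 det_tr.
  by move/esym/eqP; rewrite mulf_eq0 orbb.
pose A := B' *m invmx B.
have AA : A^T *m A = 1%:M.
  rewrite /A trmx_mul -mulmxA (mulmxA B'^T) gram trmx_inv -!mulmxA mulmxV //.
  by rewrite mulmx1 mulVmx // unitmx_tr.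
exists A, (r x - A *m q x); split=> //; first exact: mulmx1C.
move=> v; suff rv : r v - r x = A *m (q v - q x).
  by rewrite addrCA -mulmxBr -rv addrC subrK.
apply: (can_inj (mulKmx uB')).
rewrite /A !mulmxA gram -(mulmxA B^T) mulmxV // mulmx1.
by apply/colP => i; rewrite !star_mx_tr_mul dots.
Qed.

End Star.

(** * Consequences of rigidity for complex realisations *)

Section ComplexFrameworks.
Variables (V : finType) (E : rel V) (d : nat).
Hypotheses (Esym : ssrbool.symmetric E) (Eirr : ssrbool.irreflexive E).
Variables (F0 : numFieldType) (p0 : V -> 'cV[F0]_d).
Hypotheses (gp0 : generic p0) (ind0 : alg_independent (edge_values E p0))
  (ir0 : infinitesimally_rigid E p0).

(** The minimal relation at [p0] transfers to all realisations. If the value of [G] is nonzero, a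
    zero constant term would allow division by ['X], against minimality. *)
Lemma edge_relation (G : {mpoly rat[#|{: V * V}|]}) :
  exists a : {poly {mpoly rat[#|edges E|]}},
  [/\ a != 0, qeval (sqdists p0) G != 0 -> a`_0 != 0
    & forall (F : numFieldType) (q : V -> 'cV[F]_d),
      (map_poly (qeval (edge_values E q)) a).[qeval (sqdists q) G] = 0].
Proof.
have ntr := algebraic_over_edge_values Esym Eirr (G := G) ir0.
have [//|[M minM]] := minimal_relation_exists (qeval (edge_values E p0))
  (qeval (sqdists p0) G).
have [leadM M0 small] := minM; have sM := size_minimal_relation_gt1 minM.
exists M; split=> [|G0|F q]; last exact: generic_relation_transfer gp0 M0.
  by rewrite -size_poly_gt0 ltnW.
apply/eqP => a0; pose N := drop_poly 1 M.
have MN : M = N * 'X.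
  by apply/polyP => -[|i]; rewrite coefMX coef_drop_poly ?a0 // addn1.
move: M0; rewrite {1}MN rmorphM /= map_polyX hornerM hornerX => /eqP.
rewrite mulf_eq0 (negPf G0) orbF => /eqP /small.
rewrite size_drop_poly ltn_subrL (ltnW sM) => /(_ isT) N0.
move/eqP: leadM; apply; rewrite lead_coefE -coef_map.
by rewrite MN rmorphM /= N0 mul0r coef0.
Qed.

Variables (F : numClosedFieldType) (p : V -> 'cV[F]_d).
Hypothesis gp : generic p.

Lemma equivalent_independent q : equivalent E p q ->
  alg_independent (edge_values E q).
Proof.
move=> /(equivalentP Esym Eirr) pq P; rewrite -(eq_qeval pq) => P0.
by apply: ind0; exact: generic_edge_transfer gp P0.
Qed.

(** If [G] vanished at [q], the constant term of its relation would vanish at the edge values of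
    [q], which are independent. *)
Lemma equivalent_nonzero G q : equivalent E p q ->
  qeval (sqdists p0) G != 0 -> qeval (sqdists q) G != 0.
Proof.
move=> pq G0; have [a [_ /(_ G0) a0 /(_ _ q) aq]] := edge_relation G.
apply: contraNneq a0 => Gq; move: aq; rewrite Gq horner_coef0 coef_map /=.
by move/(equivalent_independent pq) ->.
Qed.

(** Each squared distance is a root of a nonzero polynomial whose coefficients depend on the edge
    values only, hence are common to all [q]. *)
Lemma equivalent_sqdist_finite : exists s : seq F, forall q a b,
  equivalent E p q -> sqnorm (q a - q b) \in s.
Proof.
have /choice[s sP] : forall ab : V * V, exists s : seq F, forall q,
    equivalent E p q -> sqnorm (q ab.1 - q ab.2) \in s.
  move=> ab; have [a [a0 _ aq]] := edge_relation 'X_(enum_rank ab).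
  have a0' : map_poly (qeval (edge_values E p)) a != 0.
    apply: contraNneq a0 => /polyP aE; apply/eqP/polyP => i.
    have := aE i; rewrite coef_map !coef0 /=.
    by apply: (equivalent_independent (q := p)) => u w.
  have [r rE] := closed_field_poly_normal (map_poly (qeval (edge_values E p)) a).
  exists r => q pq; have := aq _ q.
  rewrite qevalX /sqdists enum_rankK.
  have <- : map_poly (qeval (edge_values E p)) a =
      map_poly (qeval (edge_values E q)) a.
    by apply: eq_map_poly => P; apply: eq_qeval; exact/equivalentP.
  rewrite {1}rE hornerZ => /eqP; rewrite mulf_eq0 lead_coef_eq0 (negPf a0') /=.
  by rewrite -[_ == 0]/(root _ _) root_prod_XsubC.
exists (flatten [seq s ab | ab : V * V]) => q a b pq.
apply/flattenP; exists (s (a, b)); last exact: (sP (a, b)).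
by apply/mapP; exists (a, b); rewrite ?mem_enum.
Qed.

End ComplexFrameworks.

(** * Specialisation of the minimal polynomial *)

Lemma poly_nat_nonroot (F : numFieldType) (P : {poly F}) :
  P != 0 -> exists n : nat, P.[n%:R] != 0.
Proof.
move=> P0; apply: contrapT => /forallNP Pn.
pose rs : seq F := [seq n%:R | n <- iota 0 (size P)].
suff : (size rs < size P)%N by rewrite size_map size_iota ltnn.
apply: max_poly_roots => //.
  by apply/allP => _ /mapP[n _ ->]; have := Pn n => /negP; rewrite negbK.
by rewrite map_inj_uniq ?iota_uniq; last exact: mulrIn (oner_neq0 F).
Qed.

Lemma poly_everywhere_zero (F : numFieldType) (P : {poly F}) :
  (forall t, P.[t] = 0) -> P = 0.
Proof.
move=> P0; apply/eqP/contraT => /poly_nat_nonroot[n].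
by rewrite P0 eqxx.
Qed.

(** * Expansion along lines and arcs *)

Section LowestOrder.
Variables (F : numFieldType) (k : nat) (l0 : 'I_k -> F).

Definition line_eval (mu : 'I_k -> F) : {mpoly rat[k]} -> {poly F} :=
  mmap (polyC \o ratr) (fun i => (l0 i)%:P + 'X * (mu i)%:P).
HB.instance Definition _ mu := GRing.RMorphism.copy (line_eval mu)
  (mmap (polyC \o ratr) (fun i => (l0 i)%:P + 'X * (mu i)%:P)).

Lemma horner_line_eval mu t P :
  (line_eval mu P).[t] = qeval (fun i => l0 i + t * mu i) P.
Proof.
rewrite -[LHS]/(horner_eval t (line_eval mu P)) rmorph_mmap.
by apply: eq_mmap => i; rewrite /= /horner_eval !hornerE.
Qed.

(** The outer indeterminate records the order of expansion at [l0], the inner one is the parameter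
    of the direction [Y]; substituting the inner for the outer gives the arc. *)
Definition arc_eval (Y : 'I_k -> {poly F}) : {mpoly rat[k]} -> {poly {poly F}} :=
  mmap (polyC \o polyC \o ratr) (fun i => (l0 i)%:P%:P + 'X * (Y i)%:P).
HB.instance Definition _ Y := GRing.RMorphism.copy (arc_eval Y)
  (mmap (polyC \o polyC \o ratr) (fun i => (l0 i)%:P%:P + 'X * (Y i)%:P)).

Lemma arc_eval_line Y t P :
  map_poly (horner_eval t) (arc_eval Y P) = line_eval (fun i => (Y i).[t]) P.
Proof.
rewrite rmorph_mmap; apply: eq_mmap => i /=.
  by rewrite map_polyC /= /horner_eval hornerC.
by rewrite rmorphD rmorphM /= map_polyX !map_polyC /= /horner_eval hornerC.
Qed.

Lemma coef_arc_eval Y t P j :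
  ((arc_eval Y P)`_j).[t] = (line_eval (fun i => (Y i).[t]) P)`_j.
Proof. by rewrite -arc_eval_line coef_map. Qed.

Lemma horner_arc_eval Y t P :
  (arc_eval Y P).['X].[t] = qeval (fun i => l0 i + t * (Y i).[t]) P.
Proof.
rewrite -horner_line_eval -arc_eval_line.
by have := horner_map (horner_eval t) (arc_eval Y P) 'X;
  rewrite /= {2 3}/horner_eval hornerX.
Qed.

End LowestOrder.

Section SpecializationBound.
Variables (F : numFieldType) (V : finType) (E : rel V) (d : nat).
Variables (G : {mpoly rat[#|{: V * V}|]}) (a : {poly {mpoly rat[#|edges E|]}}).
Hypothesis aG : forall X : V -> 'cV[F]_d,
  (map_poly (qeval (edge_values E X)) a).[qeval (sqdists X) G] = 0.
Variables (l0 l1 : 'I_#|edges E| -> F).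
Hypothesis a1 : map_poly (qeval l1) a != 0.

Lemma sqnorm_arc (x y : 'cV[F]_d) t :
  sqnorm (x + t *: y) = sqnorm x + t * (dot x y *+ 2 + t * sqnorm y).
Proof. by rewrite sqnormD !sqnormE dotZr dotZl dotZr; ring. Qed.

(* The lowest-order part of [a] at [l0] along [mu] only sees the first order
   of an arc through [X] with velocity [u], whatever its curvature. *)
Lemma lowest_order_root k mu (X u : V -> 'cV[F]_d) :
  (forall j nu i, (j < k)%N -> (line_eval l0 nu a`_i)`_j = 0) ->
  edge_values E X =1 l0 ->
  (forall i, dot (X (enum_val i).1 - X (enum_val i).2)
    (u (enum_val i).1 - u (enum_val i).2) *+ 2 = mu i) ->
  (\poly_(i < size a) (line_eval l0 mu a`_i)`_k).[qeval (sqdists X) G] = 0.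
Proof.
move=> low Xl0 umu.
(* Along [Xt t] below the edge values are exactly [l0 i + t * (Y i).[t]]; [Y] starts at [mu], and
   its second term is the curvature. *)
pose Y (i : 'I_#|edges E|) : {poly F} := (mu i)%:P +
  'X * (sqnorm (u (enum_val i).1 - u (enum_val i).2))%:P.
pose Xt t v := X v + t *: u v.
have XtB t v w : Xt t v - Xt t w = (X v - X w) + t *: (u v - u w).
  by rewrite /Xt opprD addrACA scalerBr.
have YE t : (fun i => l0 i + t * (Y i).[t]) =1 edge_values E (Xt t).
  move=> i; rewrite edge_valuesE XtB sqnorm_arc umu -edge_valuesE Xl0.
  by rewrite /Y !hornerE.
pose g : {poly F} := mmap (polyC \o ratr) (fun i =>
  let v := (enum_val i).1 in let w := (enum_val i).2 in
  (sqdists X i)%:P + 'X * ((dot (X v - X w) (u v - u w) *+ 2)%:P +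
    'X * (sqnorm (u v - u w))%:P)) G.
have gE t : g.[t] = qeval (sqdists (Xt t)) G.
  rewrite -[LHS]/(horner_eval t g) rmorph_mmap; apply: eq_mmap => i /=.
    by rewrite /horner_eval hornerC.
  by rewrite /horner_eval {2}/sqdists XtB sqnorm_arc !hornerE.
(* By [low], applied to the direction [Y] at each parameter, all expansions start at order [k]; so
   ['X^k] is divided out before the parameter is set to 0. *)
pose D i := drop_poly k (arc_eval l0 Y a`_i).
have DE i : arc_eval l0 Y a`_i = D i * 'X^k.
  rewrite -[LHS](poly_take_drop k) -[RHS]add0r; congr (_ + _).
  apply/polyP => j; rewrite coef_take_poly coef0; case: ifP => // jk.
  by apply: poly_everywhere_zero => t; rewrite coef_arc_eval low.
pose T := \sum_(i < size a) (D i).['X] * g ^+ i.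
have T0 : T = 0.
  suff : 'X^k * T = 0.
    by move/eqP; rewrite mulf_eq0 (negPf (monic_neq0 (monicXn _ _))) => /eqP.
  apply: poly_everywhere_zero => t; rewrite -[RHS](aG (Xt t)) -gE.
  rewrite /T mulr_sumr horner_sum (@horner_coef_wide _ (size a)) ?size_poly //.
  apply: eq_bigr => i _; rewrite mulrA hornerM horner_exp coef_map /=.
  congr (_ * _); rewrite -(eq_qeval (YE t)) -horner_arc_eval DE.
  by rewrite [(D i * _).['X]]hornerM hornerXn mulrC.
have g0 : g.[0] = qeval (sqdists X) G.
  by rewrite gE; apply: eq_qeval => i; rewrite /sqdists XtB scale0r addr0.
have := congr1 (horner_eval 0) T0; rewrite raddf0 /T /horner_eval horner_sum.
move=> T00; rewrite -[RHS]T00 horner_poly; apply: eq_bigr => i _.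
rewrite hornerM horner_exp g0; congr (_ * _).
have -> : (D i).['X].[0] = ((D i)`_0).[0].
  have -> : (D i).['X].[0] = (map_poly (horner_eval 0) (D i)).[('X : {poly F}).[0]].
    exact: esym (horner_map (horner_eval 0) (D i) 'X).
  by rewrite hornerX horner_coef0 coef_map.
rewrite coef_drop_poly add0n coef_arc_eval.
have -> // : line_eval l0 (fun i => (Y i).[0]) a`_i = line_eval l0 mu a`_i.
by apply: eq_mmap => // j; rewrite /Y !hornerE.
Qed.

(** One direction [mu] serves all [X j], since surjectivity realises it by a velocity at each of
    them. The lowest-order part of [a] then has the [n] distinct values of [G] as roots. *)
Lemma specialization_bound n (X : 'I_n -> V -> 'cV[F]_d) :
  (forall j, edge_values E (X j) =1 l0) ->
  (forall j (mu : 'I_#|edges E| -> F), exists u : V -> 'cV[F]_d, forall i,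
    dot (X j (enum_val i).1 - X j (enum_val i).2)
      (u (enum_val i).1 - u (enum_val i).2) = mu i) ->
  injective (fun j => qeval (sqdists (X j)) G) ->
  (n < size a)%N.
Proof.
move=> Xl0 surj Xinj.
pose good k := `[< exists mu i, (line_eval l0 mu a`_i)`_k != 0 >].
have exg : exists k, good k.
  apply: contrapT => /forallNP none; move/eqP: a1; apply.
  apply/polyP => i; rewrite coef_map coef0 /=.
  (* The line from [l0] reaches [l1] at parameter 1, where [a] is nonzero, so the expansions cannot
     all vanish. *)
  pose mu j := l1 j - l0 j.
  have -> : qeval l1 a`_i = (line_eval l0 mu a`_i).[1].
    by rewrite horner_line_eval; apply: eq_qeval => j; rewrite /mu mul1r addrC subrK.
  have -> : line_eval l0 mu a`_i = 0; last by rewrite horner0.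
  apply/polyP => k; rewrite coef0; apply/eqP/negPn/negP => nz.
  by apply: (none k); apply/asboolP; exists mu, i.
case: (ex_minnP exg) => k /asboolP[mu [i nz]] kmin.
pose b := \poly_(i < size a) (line_eval l0 mu a`_i)`_k.
have b0 : b != 0.
  apply: contraNneq nz => /polyP/(_ i); rewrite coef_poly coef0.
  by have [_ -> //|/leq_sizeP ai _] := ltnP i (size a); rewrite ai // rmorph0 coef0.
apply: leq_trans (size_poly (size a) (fun i => (line_eval l0 mu a`_i)`_k)).
rewrite -/b -[n]card_ord cardE -(size_map (fun j => qeval (sqdists (X j)) G)).
apply: max_poly_roots => //; last by rewrite map_inj_uniq ?enum_uniq.
apply/allP => _ /mapP[j _ ->]; apply/rootP.
have [u uE] := surj j (fun i => mu i / 2).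
apply: (lowest_order_root (u := u)) => // [j' nu i' lt|i'].
  apply/eqP/negPn/negP => nz'; have /kmin : good j' by apply/asboolP; exists nu, i'.
  by rewrite leqNgt lt.
by rewrite uE -[LHS]mulr_natr divfK // pnatr_eq0.
Qed.

End SpecializationBound.

Definition mpoly_code n (P : {mpoly rat[n]}) : nat :=
  pickle [seq (m, P@_m) | m <- msupp P].

Lemma mpoly_code_inj n : injective (@mpoly_code n).
Proof.
move=> P Q /(pcan_inj pickleK) PQ.
have fstE (T : {mpoly rat[n]}) s : map fst [seq (m, T@_m) | m <- s] = s.
  by elim: s => //= m s ->.
have PQs : msupp P = msupp Q by have := congr1 (map fst) PQ; rewrite !fstE.
apply/mpolyP => m; have [mP|mP] := boolP (m \in msupp P); last first.
  by rewrite !memN_msupp_eq0 -?PQs.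
have : (m, P@_m) \in [seq (m, P@_m) | m <- msupp P] by apply/mapP; exists m.
by rewrite PQ => /mapP[m' _ [<-]].
Qed.

Lemma prod_XsubC_double_root (F : fieldType) (s : seq F) :
  ~~ uniq s ->
  exists2 r, r \in s & (\prod_(z <- s) ('X - z%:P))^`().[r] = 0.
Proof.
elim: s => //= z s IHs; rewrite big_cons negb_and negbK derivM derivXsubC.
case/orP => [zs|/IHs[r rs dr]].
  exists z; first exact: mem_head.
  rewrite mul1r hornerD hornerM hornerXsubC subrr mul0r addr0.
  by apply/rootP; rewrite root_prod_XsubC.
exists r; first by rewrite inE rs orbT.
rewrite mul1r hornerD hornerM dr mulr0 addr0.
by apply/rootP; rewrite root_prod_XsubC.
Qed.

(** * Conjugates of a value and the degree of its minimal relation *)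

Section ValueDegree.
Variables (F : numClosedFieldType) (V : finType) (E : rel V) (d : nat).
Hypotheses (Esym : ssrbool.symmetric E) (Eirr : ssrbool.irreflexive E).
Hypothesis uncF : forall u : nat -> F, exists c, forall n, u n != c.
Variables (p : V -> 'cV[F]_d) (G : {mpoly rat[#|{: V * V}|]}).

Let e := qeval (edge_values E p).
Let c := qeval (sqdists p) G.

(** The hypothesis is an embedding that fixes the edge values and sends [c] to [c']. Extended to the
    coordinates of [p], it carries [p] to [r]. *)
Lemma realize_value c' :
  same_kernel (ext_eval e c) (ext_eval e c') ->
  exists r, equivalent E p r /\ qeval (sqdists r) G = c'.
Proof.
move=> ker.
have code_inj : injective
    (fun P : {poly {mpoly rat[#|edges E|]}} => pickle (map (@mpoly_code _) P)).
  move=> P Q /(pcan_inj pickleK) /(inj_map (@mpoly_code_inj _)) PQ.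
  exact/val_inj.
have [B [j [e' [f' [l [ker' ej fj le]]]]]] :=
  lift_embedding uncF (point_entries p) code_inj ker.
pose X v := map_mx l (p v).
have eX v : map_mx e' (X v) = p v by rewrite map_lift.
pose r v := map_mx f' (X v).
have move_eq y z : e' y = e' z -> f' y = f' z.
  move=> yz; apply/eqP; rewrite -subr_eq0 -rmorphB -ker' rmorphB /= yz.
  by rewrite subrr.
exists r; split.
  apply/(equivalentP Esym Eirr) => i; rewrite [RHS]edge_valuesE.
  have /move_eq : e' (sqnorm (X (enum_val i).1 - X (enum_val i).2)) =
      e' (j ('X_i)%:P).
    rewrite rmorph_sqnorm !eX ej; apply/esym/(etrans (ext_evalC _ _ _)).
    by rewrite /= /e qevalX edge_valuesE.
  rewrite rmorph_sqnorm -/(r _) -/(r _) fj => ->.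
  by apply/esym/(etrans (ext_evalC _ _ _)); rewrite /= /e qevalX.
pose f := j \o polyC \o mpolyC _ (R := rat).
have /move_eq : e' (mmap f (sqdists X) G) = e' (j 'X).
  rewrite rmorph_mmap; apply/esym/(etrans (ej _)).
  apply/(etrans (ext_evalX _ _))/esym/eq_mmap => y.
    exact: etrans (ej _) (etrans (ext_evalC _ _ _) (qevalC _ _)).
  by rewrite /= /sqdists rmorph_sqnorm !eX.
rewrite rmorph_mmap => fG; have := etrans fG (etrans (fj _) (ext_evalX _ _)).
move=> <-; apply: eq_mmap => y /=; last by rewrite /sqdists rmorph_sqnorm.
exact/esym/(etrans (fj _) (etrans (ext_evalC _ _ _) (qevalC _ _))).
Qed.

(** A transcendental [c] could be moved outside the finite list [S]. So [c] is algebraic; the roots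
    of its minimal relation all lie in [S], and they are distinct by separability. *)
Lemma value_degree (S : seq F) :
  (forall r, equivalent E p r -> qeval (sqdists r) G \in S) ->
  exists a : {poly {mpoly rat[#|edges E|]}},
  [/\ (map_poly e a).[c] = 0, map_poly e a != 0 & (size a <= (size S).+1)%N].
Proof.
move=> valS; have [tr|[M minM]] := minimal_relation_exists e c.
  have [c' [tr' c'S]] := transcendental_exists uncF e S (@mpoly_code_inj _).
  have ker0 : same_kernel e e by [].
  have [r [pr rc']] := realize_value (same_kernel_transcendental ker0 tr tr').
  by have := valS r pr; rewrite rc' (negPf c'S).
have [leadM M0 _] := minM.
have sM := size_minimal_relation minM.
have eM0 : map_poly e M != 0.
  by rewrite -size_poly_gt0 sM ltnW //; exact: size_minimal_relation_gt1 minM.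
exists M; split=> //.
have [rs rsE] := closed_field_poly_normal (map_poly e M).
have lead0 : lead_coef (map_poly e M) != 0 by rewrite lead_coef_eq0.
have root_ker r : r \in rs -> same_kernel (ext_eval e c) (ext_eval e r).
  move=> rrs; apply: (same_kernel_root _ minM) => //.
  by apply/rootP; rewrite rsE rootZ // root_prod_XsubC.
have rsS : {subset rs <= S}.
  move=> r /root_ker /realize_value[q [pq <-]]; exact: valS.
have rs_uniq : uniq rs.
  apply: contraT => /prod_XsubC_double_root[r /root_ker ker dr].
  have r0 : (map_poly e M^`()).[r] = 0.
    by rewrite -deriv_map rsE derivZ hornerZ dr mulr0.
  have /eqP Mc : ext_eval e c M^`() == 0 by rewrite ker; apply/eqP.
  have := minimal_relation_deriv minM (@pchar_num F).
  by rewrite deriv_map [X in X != _]Mc eqxx.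
rewrite -sM rsE size_scale // size_prod_XsubC ltnS.
exact: uniq_leq_size.
Qed.

End ValueDegree.

(** * The spider-split *)

Section Spider.
Variables (V : finType) (E : rel V).
Hypotheses (Esym : ssrbool.symmetric E) (Eirr : ssrbool.irreflexive E).
Variables (x : V) (N1 N2 W : {set V}).
Hypotheses (d12 : [disjoint N1 & N2]) (d2W : [disjoint N2 & W])
  (Ncov : N1 :|: N2 :|: W = [set y | E x y]).

Let E' := spider_split E x N1 N2 W.

Lemma spider_nbr y : E x y = [|| y \in N1, y \in N2 | y \in W].
Proof. by have /setP/(_ y) := Ncov; rewrite !inE orbA => ->. Qed.

Lemma spider_sym : ssrbool.symmetric E'.
Proof.
move=> [a|] [b|] //=; rewrite (Esym a b).
by case: (eqVneq a x) => [?|ax]; case: (eqVneq b x) => [?|bx]; subst.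
Qed.

Lemma spider_irr : ssrbool.irreflexive E'.
Proof. by move=> [a|] //=; have [->|ax] := eqVneq a x; rewrite ?eqxx ?Eirr. Qed.

Lemma spider_fold a b : E' a b -> E (odflt x a) (odflt x b).
Proof.
have nbr y : (y \in N1) || (y \in W) -> E x y.
  by rewrite spider_nbr; case: (y \in N1) => //= ->; rewrite orbT.
have nbr2 y : (y \in N2) || (y \in W) -> E x y.
  by rewrite spider_nbr => ->; rewrite orbT.
case: a => [a|]; case: b => [b|] //=.
- case: eqP => [->|_]; first by case/andP=> _ /nbr.
  by case: eqP => [->|//] /nbr; rewrite Esym.
- by case/andP=> _ /nbr2; rewrite Esym.
- by case/andP=> _ /nbr2.
Qed.

Variables (F : numFieldType) (d : nat).
Hypothesis Wcard : #|W| = d.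

Definition star_vertex (i : 'I_d) : V := enum_val (cast_ord (esym Wcard) i).

Lemma star_vertex_inj : injective star_vertex.
Proof. by move=> i j /enum_val_inj/cast_ord_inj. Qed.

Lemma star_vertexP y : y \in W -> exists i, star_vertex i = y.
Proof.
move=> yW; exists (cast_ord Wcard (enum_rank_in yW y)).
by rewrite /star_vertex cast_ord_comp cast_ord_id enum_rankK_in.
Qed.

Lemma star_vertex_neq i : star_vertex i != x.
Proof.
apply: contraTneq (enum_valP (cast_ord (esym Wcard) i)) => ix.
apply/negP => iW; have := spider_nbr (star_vertex i).
by rewrite {2 3 4}/star_vertex iW !orbT ix Eirr.
Qed.

Definition fold_realisation (q : V -> 'cV[F]_d) (a : option V) := q (odflt x a).

(* The two copies of [x] may move apart by a vector [eta], and [d] linearly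
   independent vectors at [x] allow [eta] to be prescribed. *)
Lemma spider_surjective_sym (q : V -> 'cV[F]_d)
    (mu : option V -> option V -> F) :
  alg_independent (edge_values E q) -> \det (star_mx x star_vertex q) != 0 ->
  (forall a b, mu a b = mu b a) ->
  exists u : option V -> 'cV[F]_d, forall a b, E' a b ->
    dot (fold_realisation q a - fold_realisation q b) (u a - u b) = mu a b.
Proof.
move=> ind dB muC; pose B := star_mx x star_vertex q.
pose c := \col_i (mu (Some x) (Some (star_vertex i)) - mu None (Some (star_vertex i))).
pose eta := invmx B^T *m c.
have etaE y : y \in W ->
    dot (q x - q y) eta = mu None (Some y) - mu (Some x) (Some y).
  move=> /star_vertexP[i <-]; have := star_mx_tr_mul x star_vertex q eta i.
  rewrite /eta mulKVmx ?mxE; last by rewrite unitmx_tr unitmxE unitfE.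
  by move=> cE; rewrite -[q x - _]opprB dotC dotNr dotC -cE opprB.
(* A vertex of [N2] sees only the copy [None], of velocity [u x + eta], so the contribution of [eta]
   is subtracted in advance; on [W], [eta] supplies the difference between the two copies. *)
pose m y := if y \in N2 then mu None (Some y) - dot (q x - q y) eta
            else mu (Some x) (Some y).
pose nu a b := if a == x then m b else if b == x then m a
               else mu (Some a) (Some b).
have nuC a b : nu a b = nu b a.
  by rewrite /nu; case: (eqVneq a x) => [?|ax]; case: (eqVneq b x) => [?|bx]; subst.
have [u uE] := rigidity_surjective_sym Esym Eirr ind nuC.
pose u' (a : option V) := if a is Some v then u v else u x + eta.
exists u'; have uNone y : E' None (Some y) ->
    dot (q x - q y) (u' None - u' (Some y)) = mu None (Some y).
  move=> xy; have e := uE _ _ (spider_fold xy); rewrite /= /nu eqxx /m in e.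
  rewrite /u' addrAC dotDr e; move: xy => /=; case/andP => _.
  have [yN2 _|_ /= yW] := boolP (y \in N2); first by rewrite subrK.
  by rewrite etaE // addrC subrK.
move=> [a|] [b|] ab; rewrite /fold_realisation /=.
- rewrite (uE _ _ (spider_fold ab)) /= /nu.
  have nN2 y : (y \in N1) || (y \in W) -> y \in N2 = false.
    by case/orP; [exact: (disjointFr d12) | exact: (disjointFl d2W)].
  move: ab => /=; case: eqP => [->|_]; first by case/andP=> _ /nN2; rewrite /m => ->.
  by case: eqP => [-> /nN2|//]; rewrite /m => ->; exact: muC.
- rewrite -dotNN !opprB muC; apply: uNone; by rewrite spider_sym.
- exact: uNone.
- by [].
Qed.

Lemma spider_surjective (q : V -> 'cV[F]_d) (mu : 'I_#|edges E'| -> F) :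
  alg_independent (edge_values E q) -> \det (star_mx x star_vertex q) != 0 ->
  exists u : option V -> 'cV[F]_d, forall i,
    dot (fold_realisation q (enum_val i).1 - fold_realisation q (enum_val i).2)
      (u (enum_val i).1 - u (enum_val i).2) = mu i.
Proof.
move=> ind dB.
(* Each edge is listed in one orientation only, so on an edge the sum has exactly one term. *)
pose nu a b := \sum_(i | (enum_val i == (a, b)) || (enum_val i == (b, a))) mu i.
have [|u uE] := spider_surjective_sym (mu := nu) ind dB.
  by move=> a b; apply: eq_bigl => i; rewrite orbC.
exists u => i; rewrite uE ?edge_valP //.
rewrite /nu -surjective_pairing (bigD1 i) ?eqxx //= big1 ?addr0 // => j.
rewrite (inj_eq enum_val_inj) => /andP[/orP[->//|/eqP ji] _].
have := enum_valP i; have := enum_valP j; rewrite !inE ji /=.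
by move=> /andP[_ uw] /andP[_ wu]; have := ltn_trans uw wu; rewrite ltnn.
Qed.

End Spider.

(** * A combination of squared distances that separates realisations *)

Section Separation.
Variables (F : numFieldType) (V V' : finType) (i : V -> V') (d : nat).

Definition moment_poly (t : nat) : {mpoly rat[#|{: V' * V'}|]} :=
  \sum_(k < #|{: V * V}|)
    t%:R ^+ k *: 'X_(enum_rank (i (enum_val k).1, i (enum_val k).2)).

Lemma qeval_moment_poly t (r : V' -> 'cV[F]_d) :
  qeval (sqdists r) (moment_poly t) =
  (\sum_(k < #|{: V * V}|) sqdists (r \o i) k *: 'X^k).[t%:R].
Proof.
rewrite rmorph_sum horner_sum; apply: eq_bigr => k _ /=.
rewrite hornerZ hornerXn -mul_mpolyC rmorphM /= qevalC qevalX rmorphXn /=.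
by rewrite ratr_nat mulrC /sqdists enum_rankK.
Qed.

(** The weights [t ^ k] turn distinct distance vectors into distinct polynomials in [t]; a natural
    number that is no root of the product of their differences separates them all. *)
Lemma moment_separation n (r : 'I_n -> V' -> 'cV[F]_d) :
  (forall j l, sqdists (r j \o i) =1 sqdists (r l \o i) -> j = l) ->
  exists t, injective (fun j => qeval (sqdists (r j)) (moment_poly t)).
Proof.
move=> sep; pose P j : {poly F} := \sum_(k < #|{: V * V}|) sqdists (r j \o i) k *: 'X^k.
have Pk j (k : 'I_#|{: V * V}|) : (P j)`_k = sqdists (r j \o i) k.
  rewrite coef_sum (bigD1 k) //= coefZ coefXn eqxx mulr1 big1 ?addr0 // => l lk.
  by rewrite coefZ coefXn eq_sym (inj_eq val_inj) (negPf lk) mulr0.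
have Pinj j l : P j = P l -> j = l.
  by move=> PP; apply: sep => k; rewrite -!Pk PP.
have [|t] := @poly_nat_nonroot F
    (\prod_(jl : 'I_n * 'I_n | jl.1 != jl.2) (P jl.1 - P jl.2)).
  apply/prodf_neq0 => -[j l] /= jl; rewrite subr_eq0.
  by apply: contraNneq jl => /Pinj ->.
rewrite horner_prod => /prodf_neq0 nz; exists t => j l.
rewrite !qeval_moment_poly -/(P j) -/(P l) => jl; apply/eqP/negPn/negP => njl.
by have := nz (j, l) njl; rewrite hornerD hornerN jl subrr eqxx.
Qed.

End Separation.

(** * Comparison of the numbers of classes *)

Section SpiderCount.
Variables (F : numClosedFieldType) (V : finType) (E : rel V) (d : nat).
Hypotheses (Esym : ssrbool.symmetric E) (Eirr : ssrbool.irreflexive E).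
Hypothesis uncF : forall u : nat -> F, exists c, forall n, u n != c.
Variables (F0 : numFieldType) (p0 : V -> 'cV[F0]_d).
Hypotheses (gp0 : generic p0) (ind0 : alg_independent (edge_values E p0))
  (ir0 : infinitesimally_rigid E p0).
Variables (x : V) (N1 N2 W : {set V}).
Hypotheses (d12 : [disjoint N1 & N2]) (d2W : [disjoint N2 & W])
  (Ncov : N1 :|: N2 :|: W = [set y | E x y]) (Wcard : #|W| = d).
Variables (p : V -> 'cV[F]_d) (p' : option V -> 'cV[F]_d).
Hypotheses (gp : generic p) (gp' : generic p').

Let E' := spider_split E x N1 N2 W.

Lemma equivalent_star_mx q : equivalent E p q ->
  \det (star_mx x (star_vertex Wcard) q) != 0.
Proof.
move=> pq; have := equivalent_nonzero Esym Eirr gp0 ind0 ir0 gp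
  (G := gram_poly x (star_vertex Wcard)) pq.
have := generic_star_mx (@star_vertex_inj _ _ _ Wcard)
  (star_vertex_neq Eirr Ncov Wcard) gp0.
have nz (K : numFieldType) (y : K) : (2 ^+ d * y ^+ 2 != 0) = (y != 0).
  by rewrite mulf_eq0 !expf_eq0 pnatr_eq0 andbF.
by rewrite !qeval_gram_poly !nz => dp0; apply.
Qed.

Lemma equivalent_congruent q r : equivalent E p q ->
  sqdists q =1 sqdists r -> congruent q r.
Proof.
move=> pq qr; apply: (congruent_of_sqdist (equivalent_star_mx pq)) => a b.
by have := qr (enum_rank (a, b)); rewrite /sqdists enum_rankK.
Qed.

Lemma congruent_sqdists (T : finType) (q r : T -> 'cV[F]_d) :
  congruent q r -> sqdists q =1 sqdists r.
Proof. by move=> qr k; rewrite /sqdists (congruent_sqdist _ _ qr). Qed.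

(** The [m] representatives at [p'] yield a relation for [G] of size at most [m + 1]; its
    specialisation at the common edge values of the folded realisations [X j] forces this size above
    [n]. *)
Lemma spider_bound n m (q : 'I_n -> V -> 'cV[F]_d)
    (s : 'I_m -> option V -> 'cV[F]_d) :
  (forall j, equivalent E p (q j)) ->
  (forall j l, congruent (q j) (q l) -> j = l) ->
  (forall r, equivalent E' p' r -> exists j, congruent (s j) r) ->
  (n <= m)%N.
Proof.
move=> pq qinj sall.
have E'sym : ssrbool.symmetric E' := spider_sym Esym x N1 N2 W.
have E'irr : ssrbool.irreflexive E' := spider_irr Eirr x N1 N2 W.
pose X j := fold_realisation x (q j).
have [|t Xinj] := @moment_separation F V (option V) Some d n X.
  by move=> j l jl; apply: qinj; exact: equivalent_congruent.
pose G := moment_poly (@Some V) t.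
pose S := [seq qeval (sqdists (s j)) G | j : 'I_m].
have [|a [a0 an sa]] := value_degree E'sym E'irr uncF (p := p') (G := G) (S := S).
  move=> r /sall[j sr]; apply/mapP; exists j; rewrite ?mem_enum //.
  by apply: eq_qeval => k; rewrite (congruent_sqdists sr).
move: sa; rewrite size_map -cardE card_ord => sa; rewrite -ltnS.
apply: leq_trans sa.
apply: (specialization_bound (l0 := edge_values E' (fold_realisation x p))
  (fun r => generic_relation_transfer r gp' a0) an (X := X)) => // [j i|j mu].
  rewrite !edge_valuesE; apply/esym/pq.
  by apply: (spider_fold Esym Ncov); exact: edge_valP.
apply: (spider_surjective Esym Eirr d12 d2W Ncov (Wcard := Wcard)).
  exact: (equivalent_independent Esym Eirr ind0 gp).
exact: equivalent_star_mx.
Qed.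

Lemma spider_card_le :
  (congruence_classes E p #<= congruence_classes E' p')%card.
Proof.
pose rep (T : finType) (K : set (T -> 'cV[F]_d)) : T -> 'cV[F]_d :=
  if pselect (exists q, K = congruent q) is left exq
  then projT1 (cid exq) else fun=> 0.
have repP (T : finType) (q : T -> 'cV[F]_d) : congruent q (rep T (congruent q)).
  rewrite /rep; case: pselect => [exq|[]]; last by exists q.
  by case: cid => r /= ->; exact: congruent_refl.
have classE (T : finType) (q r : T -> 'cV[F]_d) :
    congruent q r -> congruent q = congruent r.
  move=> qr; apply/funext => y; apply/propext; split.
    exact/congruent_trans/congruent_sym.
  exact: congruent_trans.
have equiv_rep (T : finType) (D : rel T) (r q : T -> 'cV[F]_d) :
    equivalent D r q -> equivalent D r (rep T (congruent q)).
  by move=> rq a b Dab; rewrite (rq _ _ Dab) (congruent_sqdist _ _ (repP _ q)).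
have finA : finite_set (congruence_classes E p).
  have [s sP] := equivalent_sqdist_finite Esym Eirr gp0 ind0 ir0 gp.
  (* A class is encoded by the positions in [s] of the squared distances of its representative. *)
  pose h K : {ffun V * V -> 'I_(size s).+1} :=
    [ffun ab => inord (index (sqnorm (rep V K ab.1 - rep V K ab.2)) s)].
  have hinj : {in congruence_classes E p &, injective h}.
    move=> K L /set_mem[q [pq ->]] /set_mem[r [pr ->]] hKL.
    apply: classE; apply: congruent_trans (repP _ q) _.
    apply: congruent_trans (congruent_sym (repP _ r)).
    apply: equivalent_congruent => [|k]; first exact: equiv_rep.
    have sq := sP _ (enum_val k).1 (enum_val k).2 (equiv_rep _ _ _ _ pq).
    have sr := sP _ (enum_val k).1 (enum_val k).2 (equiv_rep _ _ _ _ pr).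
    have /ffunP/(_ (enum_val k)) := hKL; rewrite !ffunE => /(congr1 val) /=.
    rewrite !inordK ?ltnS ?index_size // => idx.
    by rewrite /sqdists -(nth_index 0 sq) idx nth_index.
  by rewrite -(eq_finite_set (inj_card_eq hinj)); exact: finite_finset.
(* An infinite target dominates the finite source; otherwise both sides are enumerated and
   [spider_bound] compares the lengths. *)
have [finB|infB] := EM (finite_set (congruence_classes E' p')); last first.
  exact: card_le_trans (finite_set_countable finA) (iffLR (infiniteP _) infB).
have /finite_setP[n An] := finA; have /finite_setP[m Bm] := finB.
rewrite (card_le_eql An) (card_le_eqr Bm) card_le_II.
have /card_set_bijP[f [fA finj _]] := card_esym An.
have /card_set_bijP[g [gB _ gsurj]] := card_esym Bm.
have fP (j : 'I_n) : exists q, equivalent E p q /\ f j = congruent q := fA j (ltn_ord j).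
apply: (@spider_bound n m (fun j => rep V (f j)) (fun j => rep _ (g j))).
- by move=> j; have [q [pq ->]] := fP j; exact: equiv_rep.
- move=> j l; have [q [_ fj]] := fP j; have [r [_ fl]] := fP l.
  rewrite fj fl => c; apply/val_inj/finj; rewrite ?inE /= ?ltn_ord //.
  rewrite fj fl; apply: classE; apply: congruent_trans (repP _ q) _.
  exact: congruent_trans c (congruent_sym (repP _ r)).
move=> r pr; have [j jm gj] := gsurj (congruent r) (ex_intro _ r (conj pr erefl)).
exists (Ordinal jm); rewrite /= gj; exact/congruent_sym/repP.
Qed.

End SpiderCount.

Lemma complex_uncountable (R : realType) (u : nat -> R[i]) :
  exists c, forall n, u n != c.
Proof.
have [c cP] := RealAnalysis.real_uncountable (fun n => complex.Re (u n)).
exists (c%:C)%C => n; apply: contraNneq (cP n) => ->; exact/eqP.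
Qed.

Theorem theorem4p11 (R : realType) (d : nat) (V : finType) (E : rel V)
  (Esym : ssrbool.symmetric E) (Eirr : ssrbool.irreflexive E)
  (Gmin : minimally_d_rigid R d E) (Vcard : (d.+1 <= #|V|)%N)
  (x : V) (N1 N2 W : {set V})
  (d12 : [disjoint N1 & N2]) (d1W : [disjoint N1 & W]) (d2W : [disjoint N2 & W])
  (Ncov : N1 :|: N2 :|: W = [set y | E x y]) (Wcard : #|W| = d)
  (p : V -> 'cV[R[i]]_d) (p' : option V -> 'cV[R[i]]_d)
  (gp : generic p) (gp' : generic p') :
  (congruence_classes E p #<= congruence_classes (spider_split E x N1 N2 W) p')%card.
Proof.
(* Rigidity and minimality are exploited at the real [p0]; their consequences reach the complex [p]
   through polynomial identities. *)
have [[p0 [gp0 rp0]] minE] := Gmin.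
have ind0 := minimally_rigid_independent Esym Eirr gp0 rp0 minE.
have ir0 := rigid_infinitesimally_rigid Esym Eirr rp0 ind0.
exact: (spider_card_le Esym Eirr (@complex_uncountable R) gp0 ind0 ir0 d12 d2W
  Ncov Wcard gp gp').
Qed.
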